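(* Let $K\geq 3$ be an integer and let $a(n)$ be a nonincreasing nonnegative function. Let ${\bf C}^{(1)},\dots,{\bf C}^{(K)}$ be $K$ independent simple random walks on the 2-dimensional comb lattice $\mathbb{C}^2$, all starting from $(0,0)$, and let $D_K^{\mathbb{C}^2}(n)=\max_{i\neq j,\ i,j\leq K} d({\bf C}^{(i)}(n),{\bf C}^{(j)}(n))$, where $d$ is the graph distance on $\mathbb{C}^2$. Then $$\sqrt{n}\,a(n)\in\mathrm{LLC}(D_K^{\mathbb{C}^2}(n))$$ if and only if $$\sum_{n=1}^\infty (a(2^n))^{K-2}<\infty.$$
   Context: The 2-dimensional comb lattice $\mathbb{C}^2$ is the graph obtained from the nearest-neighbour lattice $\mathbb{Z}^2$ by removing all horizontal edges off the $x$-axis. The simple random walk ${\bf C}(n)=(C_1(n),C_2(n))$ on $\mathbb{C}^2$ has transition probabilities $P({\bf C}(n+1)=(x,y\pm1)\mid{\bf C}(n)=(x,y))=\frac12$ if $y\neq0$, and $P({\bf C}(n+1)=(x\pm1,0)\mid{\bf C}(n)=(x,0))=P({\bf C}(n+1)=(x,\pm1)\mid{\bf C}(n)=(x,0))=\frac14$ (each of the indicated neighbours having the given probability). The graph distance $d(u,v)$ is the length of the shortest path in $\mathbb{C}^2$ from $u$ to $v$. LLC (lower-lower class): a function $g(n)$ belongs to $\mathrm{LLC}(Y(n))$ of a random process $\{Y(n)\}$ if for almost all $\omega$ there exists $n_0=n_0(\omega)$ such that $Y(n)>g(n)$ for all $n>n_0$. *)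

(* Defs.v *)
From HB Require Import structures.
From mathcomp Require Import all_boot all_order all_algebra.
From mathcomp Require Import all_classical all_reals all_analysis.
From mathcomp Require Import zify.
Import Order.TTheory GRing.Theory Num.Theory.

Set Implicit Arguments.
Unset Strict Implicit.
Unset Printing Implicit Defensive.

Local Open Scope classical_set_scope.
Local Open Scope ring_scope.

Notation vertex := (int * int)%type.

Definition origin : vertex := (0, 0).

Definition lattice_edge : rel vertex :=
  fun u v => `|u.1 - v.1| + `|u.2 - v.2| == 1.

Definition comb_edge : rel vertex :=
  fun u v => lattice_edge u v && ~~ ((u.2 == v.2) && (u.2 != 0)).

(* In [path], the walk u :: p has [size p] edges. *)
Definition joined_by (u v : vertex) (k : nat) : Prop :=
  exists p : seq vertex, [/\ path comb_edge u p, last u p = v & size p = k].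

Lemma joined_by_cat u v w j k :
  joined_by u v j -> joined_by v w k -> joined_by u w (j + k).
Proof.
move=> [p [pp lp sp]] [q [pq lq sq]]; exists (p ++ q); split.
- by rewrite cat_path pp lp.
- by rewrite last_cat lp.
- by rewrite size_cat sp sq.
Qed.

Lemma joined_by_edge u v : comb_edge u v -> joined_by u v 1.
Proof. by move=> uv; exists [:: v]; split => //=; rewrite uv. Qed.

Lemma comb_edge_sym : symmetric comb_edge.
Proof.
move=> u v; rewrite /comb_edge /lattice_edge (distrC v.1) (distrC v.2).
by rewrite (eq_sym v.2); have [->|] := eqVneq u.2 v.2.
Qed.

Lemma joined_by_sym u v k : joined_by u v k -> joined_by v u k.
Proof.
elim: k u => [|k IH] u [[|z p] [pp lp sp]] //.
  by exists [::]; split => //; rewrite -lp.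
move: pp sp => /= /andP[uz pz] [sp]; rewrite -addn1.
apply: (@joined_by_cat _ z); first by apply: IH; exists p.
by apply: joined_by_edge; rewrite comb_edge_sym.
Qed.

Lemma joined_origin_axis (x : int) : exists k, joined_by origin (x, 0) k.
Proof.
elim: x => [|n [k kn]|n [k kn]]; first by exists 0%N; exists [::].
- exists (k + 1)%N; apply: joined_by_cat kn _; apply: joined_by_edge.
  by rewrite /comb_edge /lattice_edge /=; lia.
- exists (k + 1)%N; apply: joined_by_cat kn _; apply: joined_by_edge.
  by rewrite /comb_edge /lattice_edge /=; lia.
Qed.

Lemma joined_axis_tooth (x y : int) : exists k, joined_by (x, 0) (x, y) k.
Proof.
elim: y => [|n [k kn]|n [k kn]]; first by exists 0%N; exists [::].
- exists (k + 1)%N; apply: joined_by_cat kn _; apply: joined_by_edge.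
  by rewrite /comb_edge /lattice_edge /=; lia.
- exists (k + 1)%N; apply: joined_by_cat kn _; apply: joined_by_edge.
  by rewrite /comb_edge /lattice_edge /=; lia.
Qed.

Lemma comb_connected u v : exists k, `[< joined_by u v k >].
Proof.
have H w : exists k, joined_by origin w k.
  case: w => x y; have [j Hj] := joined_origin_axis x.
  have [k Hk] := joined_axis_tooth x y.
  by exists (j + k)%N; apply: joined_by_cat Hj Hk.
have [j Hj] := H u; have [k Hk] := H v.
by exists (j + k)%N; apply/asboolP; apply: joined_by_cat Hk; apply: joined_by_sym.
Qed.

Definition comb_dist (u v : vertex) : nat := ex_minn (comb_connected u v).

Definition comb_step (R : realType) (u v : vertex) : R :=
  if comb_edge u v then (if u.2 == 0 then 4^-1 else 2^-1) else 0.

Section processes.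
Context (d : measure_display) (T : measurableType d) (R : realType).
Variable P : probability T R.

Definition cond_prob (A B : set T) : R := fine (P (A `&` B)) / fine (P B).

(* vertex carries the discrete sigma-algebra *)
Definition vertex_process (C : nat -> T -> vertex) : Prop :=
  forall (n : nat) (A : set vertex), measurable (C n @^-1` A).

Definition history (C : nat -> T -> vertex) (n : nat) (p : nat -> vertex) :
  set T := [set w | forall k, (k <= n)%N -> C k w = p k].

Record comb_random_walk (C : nat -> T -> vertex) : Prop := CombRandomWalk {
  comb_walk_process : vertex_process C;
  comb_walk_start : P [set w | C 0%N w = origin] = 1%E;
  comb_walk_step : forall (n : nat) (p : nat -> vertex) (v : vertex),
    (0 < P (history C n p))%E ->
    cond_prob [set w | C n.+1 w = v] (history C n p) = comb_step R (p n) v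
}.

Definition process_sigma (C : nat -> T -> vertex) : set (set T) :=
  <<s [set E | exists (n : nat) (A : set vertex), E = C n @^-1` A] >>.

Definition independent_processes (I : finType) (C : I -> nat -> T -> vertex) :
  Prop :=
  forall (J : {set I}) (E : I -> set T),
    (forall i, i \in J -> process_sigma (C i) (E i)) ->
    P (\bigcap_(i in [set` J]) E i) = (\prod_(i in J) P (E i))%E.

Definition LLC (Y : nat -> T -> R) : set (nat -> R) :=
  [set g | {ae P, forall w, exists n0 : nat,
                    forall n : nat, (n0 < n)%N -> g n < Y n w}].

Definition max_dist (K : nat) (C : 'I_K -> nat -> T -> vertex)
    (n : nat) (w : T) : nat :=
  (\max_(ij : 'I_K * 'I_K | ij.1 != ij.2)
     comb_dist (C ij.1 n w) (C ij.2 n w))%N.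

End processes.

(* Main.v *)
(* The modulus of the vertical coordinate of a walker is a folded simple random
   walk, of order sqrt n, while its horizontal coordinate is only of order
   n^(1/4).  So D(n) <= r essentially means that all K heights are O(r), as for
   a K-dimensional Bessel process, and the theorem is the Dvoretzky-Erdos test
   on dyadic blocks [2^n, 2^(n+1)).

   Upper bounds for hitting probabilities: once the walkers are within r of the
   axis, they stay within 2r for a time r^2, so the hitting probability is the
   expected occupation time divided by r^2, of order (r / 2^(n/2))^(K-2).  The
   other way for D(n) to be small is that two walkers at height r share a tooth;
   this has probability O(2^(n/4) / r), because they share their horizontal
   coordinate near the axis only O(2^(n/4)) times before time 2^n.  Hence the
   convergent half, by Borel-Cantelli.

   For the divergent half, the occupation times of the blocks, each divided by
   r^2, have a sum whose second moment is comparable to its squared mean, so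
   that infinitely many blocks are hit with positive probability. *)

Require Import Defs.
From HB Require Import structures.
From mathcomp Require Import all_boot all_order all_algebra.
From mathcomp Require Import all_classical all_reals all_analysis.
From mathcomp Require Import zify ring lra.
Import Order.TTheory GRing.Theory Num.Theory.

Set Implicit Arguments.
Unset Strict Implicit.
Unset Printing Implicit Defensive.

Local Open Scope classical_set_scope.
Local Open Scope ring_scope.

(** * Markov chains with finitely many moves *)

(** Walk estimates are stated for the averaging operator [avg], a finite sum over moves even though
    the state space is infinite; the Markov property [pr_stay] carries them to the probability
    space. Each hitting bound exhibits a function of the remaining time and the state that dominates
    the target and is superharmonic in space-time. The obstacle is that the distance also sees
    abscissas and shared teeth. Both effects are negligible at radii that exceed 2^(n/4) by a power
    of 2^n, so the radii are compared with 2^(3n/8), halfway between 2^(n/4) and 2^(n/2). Adding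
    this level to every radius in the convergent half, or discarding the blocks below it in the
    divergent half, changes the series only by a multiple of a geometric series of ratio 2^(-1/8).
    The second moment method yields only a positive probability; this suffices, because membership
    in LLC is an almost sure statement. *)

Record chain (R : realType) (S : Type) := Chain {
  chain_move : finType;
  chain_prob : S -> chain_move -> R;
  chain_next : S -> chain_move -> S;
  chain_prob_ge0 : forall s e, 0 <= chain_prob s e;
  chain_prob_sum : forall s, \sum_e chain_prob s e = 1
}.

Section chain_theory.
Variables (R : realType) (S : Type) (c : chain R S).
Implicit Types (f g : S -> R) (s : S) (n m : nat).

Definition avg f s : R :=
  \sum_e chain_prob s e * f (@chain_next R S c s e).

Definition avgn n f : S -> R := iter n avg f.
Arguments avgn : simpl never.

Lemma avgnS n f : avgn n.+1 f = avg (avgn n f).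
Proof. by []. Qed.

Lemma avgnSr n f : avgn n.+1 f = avgn n (avg f).
Proof. by rewrite /avgn iterSr. Qed.

Lemma avgnD n m f : avgn (n + m) f = avgn n (avgn m f).
Proof. by rewrite /avgn iterD. Qed.

Lemma avg_cst k s : avg (fun=> k) s = k.
Proof. by rewrite /avg -mulr_suml chain_prob_sum mul1r. Qed.

Lemma avg_add f g s : avg (fun s => f s + g s) s = avg f s + avg g s.
Proof.
by rewrite /avg -big_split; apply: eq_bigr => e _; rewrite mulrDr.
Qed.

Lemma avg_scale k f s : avg (fun s => k * f s) s = k * avg f s.
Proof. by rewrite /avg mulr_sumr; apply: eq_bigr => e _; rewrite mulrCA. Qed.

Lemma avg_sum (J : Type) (r : seq J) (p : pred J) (f : J -> S -> R) s :
  avg (fun s => \sum_(j <- r | p j) f j s) s = \sum_(j <- r | p j) avg (f j) s.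
Proof.
rewrite /avg exchange_big; apply: eq_bigr => e _ /=.
by rewrite mulr_sumr.
Qed.

Lemma avg_le_near f k s :
  (forall e, 0 < chain_prob s e -> f (@chain_next R S c s e) <= k) ->
  avg f s <= k.
Proof.
move=> fk; rewrite -[leRHS](avg_cst k s); apply: ler_sum => e _.
have := chain_prob_ge0 s e; rewrite le_eqVlt => /predU1P[<-|p0].
  by rewrite !mul0r.
by rewrite ler_pM2l// fk.
Qed.

Lemma avg_le f g s : (forall t, f t <= g t) -> avg f s <= avg g s.
Proof. by move=> fg; apply: ler_sum => e _; rewrite ler_wpM2l ?chain_prob_ge0. Qed.

Lemma avgn_cst n k s : avgn n (fun=> k) s = k.
Proof.
elim: n s => [//|n IH] s; rewrite avgnS.
by rewrite (_ : avgn n _ = fun=> k) ?avg_cst//; apply/funext.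
Qed.

Lemma avgn_add n f g s :
  avgn n (fun s => f s + g s) s = avgn n f s + avgn n g s.
Proof.
elim: n s => [//|n IH] s; rewrite !avgnS -avg_add.
by congr avg; apply/funext.
Qed.

Lemma avgn_scale n k f s : avgn n (fun s => k * f s) s = k * avgn n f s.
Proof.
elim: n s => [//|n IH] s; rewrite !avgnS -avg_scale.
by congr avg; apply/funext.
Qed.

Lemma avgn_sum n (J : Type) (r : seq J) (p : pred J) (f : J -> S -> R) s :
  avgn n (fun s => \sum_(j <- r | p j) f j s) s =
  \sum_(j <- r | p j) avgn n (f j) s.
Proof.
elim: n s => [//|n IH] s; rewrite !avgnS -avg_sum.
by congr avg; apply/funext.
Qed.

Lemma avgn_le n f g s : (forall t, f t <= g t) -> avgn n f s <= avgn n g s.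
Proof.
by move=> fg; elim: n s => [//|n IH] s; rewrite !avgnS; apply: avg_le.
Qed.

Lemma avgn_ge0 n f s : (forall t, 0 <= f t) -> 0 <= avgn n f s.
Proof. by move=> f0; rewrite -[leLHS](avgn_cst n 0 s); apply: avgn_le. Qed.

Lemma avgn_le_cst n f k s : (forall t, f t <= k) -> avgn n f s <= k.
Proof. by move=> fk; rewrite -[leRHS](avgn_cst n k s); apply: avgn_le. Qed.

(* Summing the drift of [f] along the chain counts the visits to [V]. *)
Lemma avgn_count f (V : S -> R) n s :
  (forall t, f t + V t <= avg f t) ->
  \sum_(k < n) avgn k V s <= avgn n f s - f s.
Proof.
move=> fV; elim: n => [|n IH]; first by rewrite big_ord0 subrr.
rewrite big_ord_recr/= avgnSr.
have : avgn n f s + avgn n V s <= avgn n (avg f) s.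
  by rewrite -avgn_add; apply: avgn_le.
lra.
Qed.

Lemma avgn_count_eq f (V : S -> R) n s :
  (forall t, avg f t = f t + V t) ->
  avgn n f s = f s + \sum_(k < n) avgn k V s.
Proof.
move=> fV; elim: n => [|n IH]; first by rewrite big_ord0 addr0.
rewrite big_ord_recr/= avgnSr (_ : avg f = fun t => f t + V t); last exact/funext.
by rewrite avgn_add IH addrA.
Qed.

End chain_theory.

(** Lumping: a projection that intertwines the one-step operators intertwines all their iterates. *)
Lemma avgn_proj (R : realType) (S S' : Type) (c : chain R S) (c' : chain R S')
    (p : S -> S') (f : S' -> R) n s :
  (forall f s, avg c (fun s => f (p s)) s = avg c' f (p s)) ->
  avgn c n (fun s => f (p s)) s = avgn c' n f (p s).
Proof.
move=> pE; elim: n f s => [//|n IH] f s; rewrite !avgnSr -IH.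
by congr avgn; apply/funext => t; rewrite pE.
Qed.

(** * The folded walk *)

(* The modulus of the vertical coordinate of the comb walk is a simple random
   walk on [nat] that stays put at 0 with probability 1/2, i.e. the simple
   random walk on [int] folded around -1/2; [s.-1] encodes the fold. *)
Section folded_walk.
Variable R : realType.

Let half (s : nat) (e : bool) : R := 2^-1.

Let half_ge0 s e : 0 <= half s e.
Proof. by rewrite invr_ge0. Qed.

Let half_sum s : \sum_e half s e = 1.
Proof. by rewrite big_bool /half /=; lra. Qed.

Definition folded_walk : chain R nat :=
  @Chain R nat bool half (fun s e => if e then s.+1 else s.-1)
    half_ge0 half_sum.

Local Notation fw := folded_walk.

Lemma avg_folded g s : avg fw g s = (g s.+1 + g s.-1) / 2.
Proof. by rewrite /avg big_bool /= /half; lra. Qed.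

(** Both moves, [s.+1] and [s.-1], are nondecreasing in [s], so averaging preserves monotonicity. *)
Lemma folded_noninc n (g : nat -> R) :
  (forall s, g s.+1 <= g s) -> forall s, avgn fw n g s.+1 <= avgn fw n g s.
Proof.
move=> gd; elim: n => [//|n IH] s; rewrite avgnS !avg_folded /=.
by case: s => [|s] /=; [have := IH 1%N; have := IH 0%N|
  have := IH s.+2; have := IH s.+1; have := IH s]; lra.
Qed.

Lemma folded_noninc_le n (g : nat -> R) s t :
  (forall s, g s.+1 <= g s) -> (s <= t)%N -> avgn fw n g t <= avgn fw n g s.
Proof.
move=> gd; elim: t => [|t IH]; first by rewrite leqn0 => /eqP ->.
rewrite leq_eqVlt => /predU1P[->//|]; rewrite ltnS => /IH.
exact/le_trans/folded_noninc.
Qed.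

Definition fwpt (t s : nat) : R := (s == t)%:R.

Lemma avg_fwpt t : avg fw (fwpt t) = fun s => 2^-1 * (fwpt t.-1 s + fwpt t.+1 s).
Proof.
apply/funext => s; rewrite avg_folded /fwpt mulrC; congr (_ * _).
rewrite -!natrD; congr (_%:R); lia.
Qed.

(** The holding at 0 makes counting measure reversible. This exchanges target and starting point, so
    that [folded_noninc] also describes the mass as a function of the target. *)
Lemma folded_sym n s t : avgn fw n (fwpt t) s = avgn fw n (fwpt s) t.
Proof.
elim: n s t => [|n IH] s t; first by rewrite /= /fwpt eq_sym.
rewrite avgnS avgnSr avg_folded avg_fwpt avgn_scale avgn_add !(IH _ t).
by rewrite mulrC addrC.
Qed.

Definition fwret n : R := avgn fw n (fwpt 0) 0%N.

Lemma fwret_ge0 n : 0 <= fwret n.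
Proof. by apply: avgn_ge0 => t; rewrite /fwpt ler0n. Qed.

Lemma fwpt0_noninc s : fwpt 0 s.+1 <= fwpt 0 s.
Proof. by rewrite /fwpt /= ler0n. Qed.

Lemma fwret_noninc n m : (n <= m)%N -> fwret m <= fwret n.
Proof.
elim: m => [|m IH]; first by rewrite leqn0 => /eqP ->.
rewrite leq_eqVlt => /predU1P[->//|]; rewrite ltnS => /IH.
apply: le_trans; rewrite /fwret avgnS avg_folded /=.
have := folded_noninc m fwpt0_noninc 0; lra.
Qed.

Lemma folded_pt_le n t : avgn fw n (fwpt t) 0%N <= fwret n.
Proof. by rewrite folded_sym; apply: folded_noninc_le fwpt0_noninc _. Qed.

(** Discrete Tanaka formula: the height has drift 1/2 at 0 and none elsewhere. *)
Lemma folded_abs n : avgn fw n (fun s => s%:R) 0%N = 2^-1 * \sum_(k < n) fwret k.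
Proof.
rewrite (@avgn_count_eq _ _ _ _ (fun s => 2^-1 * fwpt 0 s)) ?add0r.
  by rewrite mulr_sumr; apply: eq_bigr => k _; rewrite avgn_scale.
move=> [|s]; rewrite avg_folded /fwpt /=; first by lra.
by rewrite -(@natr1 R s) -(@natr1 R s.+1) -(@natr1 R s); lra.
Qed.

Lemma folded_sqr n s : avgn fw n (fun s => s%:R ^+ 2) s <= s%:R ^+ 2 + n%:R.
Proof.
elim: n => [|n IH]; first by rewrite addr0.
rewrite avgnSr; apply: (@le_trans _ _ (avgn fw n (fun s => s%:R ^+ 2 + 1) s)).
  apply: avgn_le => -[|t]; rewrite avg_folded /=; first by lra.
  by rewrite -(@natr1 R t) -(@natr1 R t.+1) -(@natr1 R t); nra.
by rewrite avgn_add avgn_cst -natr1; lra.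
Qed.

Lemma folded_abs_le n : avgn fw n (fun s => s%:R) 0%N <= Num.sqrt n%:R.
Proof.
have [->|n0] := posnP n; first by rewrite sqrtr0.
set l : R := Num.sqrt n%:R.
have l0 : 0 < l by rewrite sqrtr_gt0 ltr0n.
have l2 : l ^+ 2 = n%:R by rewrite sqr_sqrtr ?ler0n.
(* The inequality s <= (s^2 + l^2) / (2 l) plays the role of Cauchy-Schwarz. *)
apply: (@le_trans _ _ (avgn fw n (fun s => (2 * l)^-1 * (s%:R ^+ 2 + l ^+ 2)) 0%N)).
  apply: avgn_le => t; rewrite ler_pdivlMl ?mulr_gt0//.
  by have := sqr_ge0 (t%:R - l); nra.
rewrite avgn_scale avgn_add avgn_cst ler_pdivrMl ?mulr_gt0//.
by have := folded_sqr n 0; rewrite expr0n /= add0r -l2; nra.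
Qed.

(** Return probabilities decrease, so n times the last is at most their sum, which is twice the mean
    height and hence at most 2 sqrt n. This replaces a local limit theorem. *)
Lemma fwret_le n : fwret n * Num.sqrt n%:R <= 2.
Proof.
have [->|n0] := posnP n; first by rewrite sqrtr0 mulr0.
have := folded_abs_le n; rewrite folded_abs.
have : n%:R * fwret n <= \sum_(k < n) fwret k.
  rewrite -[leLHS](_ : \sum_(k < n) fwret n = _).
    by apply: ler_sum => k _; apply/fwret_noninc/ltnW.
  by rewrite sumr_const card_ord mulr_natl.
set l : R := Num.sqrt n%:R => h1 h2.
have l2 : l ^+ 2 = n%:R by rewrite sqr_sqrtr ?ler0n.
have l0 : 0 < l by rewrite sqrtr_gt0 ltr0n.
rewrite -(ler_pM2r l0); move: h1 h2; rewrite -l2 expr2.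
by set x := \sum_(_ < _) _; nra.
Qed.

Definition fwball (r s : nat) : R := (s <= r)%:R.

Lemma fwball_sum r : fwball r = fun s => \sum_(t < r.+1) fwpt t s.
Proof.
apply/funext => s; rewrite /fwball /fwpt -natr_sum; congr (_%:R).
elim: r => [|r IH]; first by rewrite big_ord1 leqn0.
by rewrite big_ord_recr /= -IH; lia.
Qed.

Lemma fwball_noninc r s : fwball r s.+1 <= fwball r s.
Proof. by rewrite /fwball ler_nat; case: (leqP s.+1 r) => //= /ltnW ->. Qed.

Lemma folded_ball_le n r s :
  avgn fw n (fwball r) s <= r.+1%:R * fwret n.
Proof.
apply: (@le_trans _ _ (avgn fw n (fwball r) 0%N)).
  exact: folded_noninc_le (@fwball_noninc r) _.
rewrite fwball_sum avgn_sum -[leRHS](_ : \sum_(t < r.+1) fwret n = _).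
  by apply: ler_sum => t _; exact: folded_pt_le.
by rewrite sumr_const card_ord mulr_natl.
Qed.

(** From 0 the mass of a point decreases with its height, so the mean mass per point of a ball
    decreases with its radius. *)
Lemma folded_ball_mono n r t : (r <= t)%N ->
  r.+1%:R * avgn fw n (fwball t) 0%N <= t.+1%:R * avgn fw n (fwball r) 0%N.
Proof.
move=> rt; rewrite !fwball_sum !avgn_sum.
under eq_bigr do rewrite folded_sym.
under [in leRHS]eq_bigr do rewrite folded_sym.
elim: t rt => [|t IH]; first by rewrite leqn0 => /eqP ->.
rewrite leq_eqVlt => /predU1P[->//|]; rewrite ltnS => rt.
rewrite big_ord_recr/= mulrDr -(@natr1 R t.+1) mulrDl mul1r lerD ?IH//.
rewrite -[leLHS](_ : \sum_(k < r.+1) avgn fw n (fwpt 0) t.+1 = _).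
  apply: ler_sum => k _; apply: folded_noninc_le fwpt0_noninc _.
  by have := ltn_ord k; lia.
by rewrite sumr_const card_ord mulr_natl.
Qed.

(* Chebyshev: half of the mass sits in a window of width of order [sqrt n], and
   by unimodality the ball of radius [r] holds its proportional share. *)
Lemma folded_ball_ge n r : (0 < n)%N -> r%:R <= 2 * Num.sqrt n%:R :> R ->
  r.+1%:R <= 6 * Num.sqrt n%:R * avgn fw n (fwball r) 0%N.
Proof.
move=> n0 rn; set l : R := Num.sqrt n%:R in rn *.
have l1 : 1 <= l by rewrite -sqrtr1 ler_sqrt ?ler1n ?ler0n.
have l2 : l ^+ 2 = n%:R by rewrite sqr_sqrtr ?ler0n.
set t := Num.truncn (2 * l).
have /andP[tl lt] : t%:R <= 2 * l < t.+1%:R by apply: truncn_itv; lra.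
have rt : (r <= t)%N by rewrite truncn_ge_nat//; lra.
have l4 : 0 < 4 * l ^+ 2 by nra.
have h := folded_ball_mono n rt.
(* The second moment is at most l^2 and the threshold is 2 l, so at most a quarter of the mass
   escapes. *)
have big : 3 / 4 <= avgn fw n (fwball t) 0%N.
  have : avgn fw n (fun s => 1 + - (4 * l ^+ 2)^-1 * s%:R ^+ 2) 0%N <=
      avgn fw n (fwball t) 0%N.
    apply: avgn_le => s; rewrite /fwball; have [st|ts] := leqP s t.
      have : 0 <= (4 * l ^+ 2)^-1 * s%:R ^+ 2.
        by apply: mulr_ge0 (sqr_ge0 _); rewrite invr_ge0 pmulr_rge0 ?sqr_ge0.
      by rewrite mulNr /=; lra.
    rewrite mulNr subr_le0 ler_pdivlMl//.
    have : t.+1%:R <= s%:R :> R by rewrite ler_nat.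
    by nra.
  rewrite avgn_add avgn_cst avgn_scale; apply: le_trans.
  have := folded_sqr n 0; rewrite expr0n /= add0r -l2 => h2.
  suff : (4 * l ^+ 2)^-1 * avgn fw n (fun s : nat => s%:R ^+ 2) 0%N <= 4^-1 by lra.
  by rewrite ler_pdivrMl//; lra.
have p0 : 0 <= avgn fw n (fwball r) 0%N by apply: avgn_ge0 => s; rewrite ler0n.
have r0 : 0 <= r.+1%:R :> R by rewrite ler0n.
have tl' : t.+1%:R <= 3 * l by rewrite -natr1; lra.
move: p0 h big; set x := avgn _ _ (fwball r) _; set y := avgn _ _ _ _.
nra.
Qed.

End folded_walk.
Arguments avgn : simpl never.

(** * The comb walk and independent copies *)

Section product_chain.
Variables (R : realType) (S : Type) (c : chain R S) (I : finType).
Implicit Types (z : {ffun I -> S}).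

Let prod_prob z (e : {ffun I -> chain_move c}) : R :=
  \prod_i chain_prob (z i) (e i).

Let prod_next z (e : {ffun I -> chain_move c}) : {ffun I -> S} :=
  [ffun i => chain_next (z i) (e i)].

Let prod_prob_ge0 z e : 0 <= prod_prob z e.
Proof. by apply: prodr_ge0 => i _; apply: chain_prob_ge0. Qed.

Let prod_prob_sum z : \sum_e prod_prob z e = 1.
Proof.
rewrite /prod_prob -(bigA_distr_bigA (fun i e => chain_prob (z i) e)).
by rewrite big1// => i _; rewrite chain_prob_sum.
Qed.

Definition prod_chain : chain R {ffun I -> S} :=
  @Chain R _ _ prod_prob prod_next prod_prob_ge0 prod_prob_sum.

Lemma avg_prod (f : I -> S -> R) z :
  avg prod_chain (fun z => \prod_i f i (z i)) z = \prod_i avg c (f i) (z i).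
Proof.
rewrite /avg /= (bigA_distr_bigA (fun i e => chain_prob (z i) e *
  f i (chain_next (z i) e))); apply: eq_bigr => e _.
by rewrite /prod_prob -big_split; apply: eq_bigr => i _; rewrite ffunE.
Qed.

Lemma avgn_prod n (f : I -> S -> R) z :
  avgn prod_chain n (fun z => \prod_i f i (z i)) z =
  \prod_i avgn c n (f i) (z i).
Proof.
elim: n f z => [//|n IH] f z.
rewrite avgnSr (_ : avg _ _ = fun z => \prod_i avg c (f i) (z i)); last first.
  by apply/funext => t; rewrite avg_prod.
rewrite (IH (fun i => avg c (f i))).
by apply: eq_bigr => i _; rewrite avgnSr.
Qed.

Lemma avg_coord i (f : S -> R) z :
  avg prod_chain (fun z => f (z i)) z = avg c f (z i).
Proof.
have E (g : S -> R) (t : {ffun I -> S}) :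
    g (t i) = \prod_k (if k == i then g (t k) else 1) :> R.
  by rewrite (bigD1 i)//= eqxx big1 ?mulr1// => k /negbTE ->.
rewrite (_ : (fun z => f (z i)) =
    fun z => \prod_k (if k == i then f else fun=> 1) (z k)); last first.
  by apply/funext => t; rewrite E; apply: eq_bigr => k _; case: eqP.
rewrite (avg_prod (fun k => if k == i then f else fun=> 1)) E.
by apply: eq_bigr => k _; case: eqP => // _; rewrite avg_cst.
Qed.

Lemma avgn_coord n i (f : S -> R) z :
  avgn prod_chain n (fun z => f (z i)) z = avgn c n f (z i).
Proof.
by apply: (avgn_proj (p := fun z : {ffun I -> S} => z i)) => g t; exact: avg_coord.
Qed.

(** Fixing the moves [a], [b] of the two coordinates by indicators keeps the weight a product over
    all coordinates, so that distributivity turns the product of the two marginals into a sum over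
    joint moves. *)
Lemma avg_coord2 i j (F : S -> S -> R) z : i != j ->
  avg prod_chain (fun z => F (z i) (z j)) z =
  avg c (fun u => avg c (F u) (z j)) (z i).
Proof.
move=> ij.
pose p k := chain_prob (c := c) (z k).
pose n k := chain_next (c := c) (z k).
pose w a b k e : R :=
  p k e * (if k == i then (e == a)%:R else if k == j then (e == b)%:R else 1).
have pE k a : p k a = \sum_e p k e * (e == a)%:R.
  rewrite (bigD1 a)//= eqxx mulr1 big1 ?addr0// => e /negbTE ->.
  by rewrite mulr0.
have ji : (j == i) = false by rewrite eq_sym (negbTE ij).
have wE a b : p i a * p j b = \prod_k \sum_e w a b k e.
  transitivity ((\sum_e w a b i e) * (\sum_e w a b j e)).
    by rewrite !pE; congr (_ * _); apply: eq_bigr => e _; rewrite /w ?ji !eqxx.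
  rewrite [RHS](bigD1 i)//= (bigD1 j (negbT ji))/= mulrA.
  rewrite [X in _ = _ * X]big1 ?mulr1//.
  move=> k /andP[ki kj]; rewrite /w (negbTE ki) (negbTE kj).
  by under eq_bigr do rewrite mulr1; exact: chain_prob_sum.
transitivity (\sum_a \sum_b p i a * p j b * F (n i a) (n j b)); last first.
  apply: eq_bigr => a _; rewrite mulr_sumr; apply: eq_bigr => b _.
  by rewrite mulrA.
transitivity (\sum_a \sum_b \sum_(e : {ffun I -> chain_move c})
    (\prod_k w a b k (e k)) * F (n i a) (n j b)); last first.
  apply: eq_bigr => a _; apply: eq_bigr => b _.
  by rewrite wE bigA_distr_bigA mulr_suml.
under [RHS]eq_bigr do rewrite exchange_big.
rewrite exchange_big; apply: eq_bigr => e _ /=.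
have WE a b : \prod_k w a b k (e k) =
    (\prod_k p k (e k)) * ((e i == a)%:R * (e j == b)%:R).
  rewrite big_split; congr (_ * _).
  rewrite (bigD1 i)//= (bigD1 j (negbT ji))/= ji !eqxx mulrA.
  by rewrite big1 ?mulr1// => k /andP[/negbTE -> /negbTE ->].
rewrite (bigD1 (e i))//= [X in _ = _ + X]big1 ?addr0 => [|a ai]; last first.
  rewrite big1// => b _.
  by rewrite WE (eq_sym (e i)) (negbTE ai) mul0r mulr0 mul0r.
rewrite (bigD1 (e j))//= [X in _ = _ + X]big1 ?addr0 => [|b bj]; last first.
  by rewrite WE (eq_sym (e j)) (negbTE bj) !mulr0 mul0r.
by rewrite WE !eqxx !mulr1 !ffunE.
Qed.

End product_chain.

Section comb_chain.
Variable R : realType.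

(** [e.1] tells whether the move is vertical, [e.2] gives its sign. Horizontal moves off the axis
    are kept with probability 0, so that all vertices share one set of moves. *)
Let prob (v : vertex) (e : bool * bool) : R :=
  if v.2 == 0 then 4^-1 else if e.1 then 2^-1 else 0.

Definition comb_next (v : vertex) (e : bool * bool) : vertex :=
  let s : int := if e.2 then 1 else -1 in
  if e.1 then (v.1, v.2 + s) else (v.1 + s, v.2).

Let prob_ge0 v e : 0 <= prob v e.
Proof. by rewrite /prob; case: ifP; rewrite ?invr_ge0//; case: ifP; rewrite ?invr_ge0. Qed.

Lemma big_dir (F : bool * bool -> R) :
  \sum_e F e = F (true, true) + F (true, false) + F (false, true) +
    F (false, false).
Proof.
rewrite (eq_bigr (fun p => F (p.1, p.2))) => [|[]//].
by rewrite -(pair_bigA _ (fun a b => F (a, b))) /= !big_bool /= addrA.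
Qed.

Let prob_sum v : \sum_e prob v e = 1.
Proof. by rewrite big_dir /prob /=; case: ifP => _; lra. Qed.

Definition comb_chain : chain R vertex :=
  @Chain R vertex _ prob comb_next prob_ge0 prob_sum.

Local Notation cc := comb_chain.

Lemma comb_next_inj v : injective (comb_next v).
Proof.
move=> [[] []] [[] []] //; rewrite /comb_next /= => /eqP;
  by rewrite xpair_eqE => /andP[/eqP h1 /eqP h2]; lia.
Qed.

Lemma comb_step_next v e : comb_step R v (comb_next v e) = chain_prob (c := cc) v e.
Proof.
have E : comb_edge v (comb_next v e) = (v.2 == 0) || e.1.
  by case: v e => x y [[] []]; rewrite /comb_edge /lattice_edge /comb_next /=; lia.
by rewrite /comb_step E /= /prob; case: (v.2 == 0) => //=; case: (e.1).
Qed.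

Lemma avg_comb_axis (f : vertex -> R) (x : int) :
  avg cc f (x, 0) = (f (x, 1) + f (x, -1) + f (x + 1, 0) + f (x - 1, 0)) / 4.
Proof. by rewrite /avg big_dir /= /prob /comb_next /= !add0r; lra. Qed.

Lemma avg_comb_tooth (f : vertex -> R) (x y : int) : y != 0 ->
  avg cc f (x, y) = (f (x, y + 1) + f (x, y - 1)) / 2.
Proof. by move=> y0; rewrite /avg big_dir /= /prob /comb_next /= (negbTE y0); lra. Qed.

Lemma avg_comb_height (g : nat -> R) v :
  avg cc (fun v => g `|v.2|%N) v = avg (folded_walk R) g `|v.2|%N.
Proof.
case: v => x y /=; have [->|y0] := eqVneq y 0.
  by rewrite avg_comb_axis avg_folded /= ?absz0; lra.
rewrite avg_comb_tooth// avg_folded /=.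
case: y y0 => [[|n]|n] // _.
  have -> : absz (Posz n.+1 + 1)%R = n.+2 by lia.
  have -> : absz (Posz n.+1 - 1)%R = n by lia.
  by [].
have -> : absz (Negz n + 1)%R = n by lia.
have -> : absz (Negz n - 1)%R = n.+2 by lia.
by rewrite addrC.
Qed.

Lemma avgn_comb_height n (g : nat -> R) v :
  avgn cc n (fun v => g `|v.2|%N) v = avgn (folded_walk R) n g `|v.2|%N.
Proof.
apply: (avgn_proj (p := fun v : vertex => `|v.2|%N)); exact: avg_comb_height.
Qed.

(** On the axis both x^2 and |y| have drift 1/2; off it neither has any. Hence E x^2 equals the mean
    height, which is why horizontal displacements are of order n^(1/4). *)
Lemma avgn_sqr_sub_height n v :
  avgn cc n (fun v => (v.1%:~R : R) ^+ 2 - `|v.2|%:R) v = v.1%:~R ^+ 2 - `|v.2|%:R.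
Proof.
elim: n v => [//|n IH] v; rewrite avgnSr -[RHS]IH; congr avgn.
apply/funext => {v}-[x y] /=.
have [->|y0] := eqVneq y 0.
  by rewrite avg_comb_axis /= ?absz0 !rmorphD /= rmorphN /=; lra.
rewrite avg_comb_tooth//=.
suff : ((absz (y + 1)%R)%:R : R) + (absz (y - 1)%R)%:R = 2 * (absz y)%:R by lra.
by rewrite -natrD -natrM; congr (_%:R); lia.
Qed.

Lemma comb_sqr_le n : avgn cc n (fun v => (v.1%:~R : R) ^+ 2) origin <= Num.sqrt n%:R.
Proof.
have := avgn_sqr_sub_height n origin.
rewrite (_ : (fun v => _) = fun v : vertex =>
  (v.1%:~R : R) ^+ 2 + (-1) * `|v.2|%:R); last by apply/funext => v; rewrite mulN1r.
rewrite avgn_add avgn_scale (avgn_comb_height n (fun s => s%:R)) /=.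
by rewrite expr0n /= subrr => h; have := folded_abs_le R n; lra.
Qed.

Lemma comb_sqr_submg v : (v.1%:~R : R) ^+ 2 <= avg cc (fun v => (v.1%:~R : R) ^+ 2) v.
Proof.
case: v => x y; have [->|y0] := eqVneq y 0.
  by rewrite avg_comb_axis /= !rmorphD /= rmorphN /=; nra.
by rewrite avg_comb_tooth//=; lra.
Qed.

End comb_chain.

(** * From the probability space to the transition operator *)

Section finite_combinations.
Context (d : measure_display) (T : measurableType d) (R : realType).
Variable P : probability T R.

Definition pr (A : set T) : R := fine (P A).

Lemma prE A : measurable A -> P A = (pr A)%:E.
Proof. by move=> mA; rewrite /pr fineK// fin_num_measure. Qed.

Lemma pr_ge0 A : 0 <= pr A.
Proof. by rewrite /pr fine_ge0. Qed.

(** Integrates a finite combination of indicators. Through it, linear inequalities between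
    probabilities are checked pointwise. *)
Lemma pr_comb_ge0 (J : Type) (r : seq J) (c : J -> R) (A : J -> set T) :
  (forall j, measurable (A j)) ->
  (forall w, 0 <= \sum_(j <- r) c j * \1_(A j) w) ->
  0 <= \sum_(j <- r) c j * pr (A j).
Proof.
move=> mA c0.
pose f r w : R := \sum_(j <- r) c j * \1_(A j) w.
suff [_ fE] : P.-integrable setT (EFin \o f r) /\
    (\int[P]_w (f r w)%:E)%E = (\sum_(j <- r) c j * pr (A j))%:E.
  by rewrite -lee_fin -fE; apply: integral_ge0 => w _; rewrite lee_fin; exact: c0.
elim: r {c0} => [|j r [IH1 IH2]].
  rewrite big_nil (_ : f [::] = cst 0); last first.
    by apply/funext => w; rewrite /f big_nil.
  by split; [exact: integrable0|rewrite integral0].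
rewrite big_cons (_ : f (j :: r) = (fun w => c j * \1_(A j) w) \+ f r); last first.
  by apply/funext => w; rewrite /f big_cons.
have int1 : P.-integrable setT (EFin \o (fun w => c j * \1_(A j) w)).
  have := integrableZl measurableT (c j) (integrable_indic P (mA j)).
  by apply: eq_integrable => // w _; rewrite /= EFinM.
split.
  have := integrableD measurableT int1 IH1.
  by apply: eq_integrable => // w _; rewrite /= EFinD.
under eq_integral do rewrite /= EFinD.
rewrite integralD_EFin// IH2 EFinD; congr (_ + _)%E.
under eq_integral do rewrite /= EFinM.
rewrite integralZl//; last exact: integrable_indic.
by rewrite EFinM -prE// integral_indic// setIT.
Qed.

Lemma pr_comb_le (J K : Type) (r : seq J) (s : seq K) (c : J -> R) (e : K -> R)
    (A : J -> set T) (B : K -> set T) :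
  (forall j, measurable (A j)) -> (forall k, measurable (B k)) ->
  (forall w, \sum_(j <- r) c j * \1_(A j) w <= \sum_(k <- s) e k * \1_(B k) w) ->
  \sum_(j <- r) c j * pr (A j) <= \sum_(k <- s) e k * pr (B k).
Proof.
move=> mA mB le; rewrite -subr_ge0.
pose F (x : J + K) := match x with inl j => A j | inr k => B k end.
pose h (x : J + K) := match x with inl j => - c j | inr k => e k end.
have E (G : set T -> R) : \sum_(x <- map inl r ++ map inr s) h x * G (F x) =
    \sum_(k <- s) e k * G (B k) - \sum_(j <- r) c j * G (A j).
  rewrite big_cat !big_map /= addrC -sumrN; congr (_ + _).
  by apply: eq_bigr => j _; rewrite mulNr.
rewrite -E; apply: pr_comb_ge0 => [[]//|w].
by rewrite (E (fun A => \1_A w)) subr_ge0.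
Qed.

Lemma pr_le A B : measurable A -> measurable B -> A `<=` B -> pr A <= pr B.
Proof.
move=> mA mB AB; rewrite /pr fine_le ?fin_num_measure//.
by rewrite le_measure ?inE.
Qed.

Lemma prC A : measurable A -> pr (~` A) = 1 - pr A.
Proof.
by move=> mA; rewrite /pr probability_setC// prE// -EFinB.
Qed.

Lemma pr_setT : pr setT = 1.
Proof. by rewrite /pr probability_setT. Qed.

Lemma pr_setI1 A B : measurable A -> measurable B -> pr B = 1 -> pr (A `&` B) = pr A.
Proof.
move=> mA mB B1; apply/eqP; rewrite eq_le pr_le//=; last exact: measurableI.
have mAB := measurableI _ _ mA mB.
have := @pr_comb_le bool bool [:: true; false] [:: true; false]
  (fun=> 1) (fun=> 1) (fun b => if b then A else B)
  (fun b => if b then A `&` B else setT).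
rewrite !big_cons !big_nil !mul1r !addr0 B1 pr_setT lerD2r; apply.
- by case.
- by case.
move=> w; rewrite !big_cons !big_nil !mul1r !addr0 !indicE in_setI in_setT.
by case: (w \in A); case: (w \in B); rewrite /= ?addr0 ?add0r ?lexx ?ler01 ?lerDr.
Qed.

Lemma prIC A B : measurable A -> measurable B ->
  pr (A `&` B) + pr (A `&` ~` B) = pr A.
Proof.
move=> mA mB; have mAB := measurableI _ _ mA mB.
have mAC := measurableI _ _ mA (measurableC mB).
apply: EFin_inj; rewrite EFinD -!prE// -measureU//.
  by rewrite -setIUr setUv setIT.
by rewrite setIACA setICr setI0.
Qed.

End finite_combinations.

Section stay.
Variables (R : realType) (S : Type) (c : chain R S).

(* The probability, from [z], of being in [B k] at every time [k <= n]. *)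
Fixpoint stay (B : nat -> S -> bool) (n : nat) (z : S) : R :=
  if n is m.+1 then (B 0%N z)%:R * avg c (stay (fun k => B k.+1) m) z
  else (B 0%N z)%:R.

End stay.

Section walks.
Context (d : measure_display) (T : measurableType d) (R : realType).
Variable P : probability T R.

(** The measurable space is arbitrary so that the lemma also applies to the sigma-algebra generated
    by the walk itself, as independence requires. *)
Lemma measurable_history d' (T' : measurableType d') (C : nat -> T' -> vertex) n p :
  vertex_process C -> measurable (history C n p).
Proof.
move=> mC.
rewrite (_ : history C n p = \bigcap_(k in [set k | (k <= n)%N]) (C k @^-1` [set p k])).
  by apply: bigcap_measurableType => k _; exact: mC.
by apply/seteqP; split => w h k kn; exact: h.
Qed.

Lemma process_sigma_history (C : nat -> T -> vertex) n p :
  process_sigma C (history C n p).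
Proof.
pose G := [set E | exists (n : nat) (A : set vertex), E = C n @^-1` A].
apply: (@measurable_history _ (g_sigma_algebraType G) C).
by move=> k A; apply: sub_sigma_algebra; exists k, A.
Qed.

Lemma pr_history_step (C : nat -> T -> vertex) n p : comb_random_walk P C ->
  pr P (history C n.+1 p) = pr P (history C n p) * comb_step R (p n) (p n.+1).
Proof.
move=> [mC _ stepC].
have mH := measurable_history n p mC.
have E : history C n.+1 p = [set w | C n.+1 w = p n.+1] `&` history C n p.
  apply/seteqP; split => w.
    by move=> h; split; [exact: h|move=> k kn; exact/h/leqW].
  by move=> [h1 h2] k; rewrite leq_eqVlt => /predU1P[->//|]; exact: h2.
(* The transition hypothesis is silent on null histories, where both sides vanish. *)
have := measure_ge0 P (history C n p); rewrite le_eqVlt => /predU1P[H0|Hgt].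
  have -> : pr P (history C n p) = 0 by rewrite /pr -H0.
  rewrite mul0r; apply/eqP; rewrite eq_le pr_ge0 andbT.
  have <- : pr P (history C n p) = 0 by rewrite /pr -H0.
  apply: pr_le => //; first exact: measurable_history.
  by rewrite E; exact: subIsetr.
rewrite -(stepC _ _ _ Hgt) /cond_prob -E mulrC divfK//.
have /gt_eqF -> // : 0 < pr P (history C n p) by rewrite -lte_fin -prE.
Qed.

Variables (I : finType) (C : I -> nat -> T -> vertex).
Hypothesis hC : forall i, comb_random_walk P (C i).
Hypothesis hind : independent_processes P C.

Local Notation st := {ffun I -> vertex}.
Local Notation Q := (prod_chain (comb_chain R) I).

Definition start : st := [ffun=> origin].

Definition state (n : nat) (w : T) : st := [ffun i => C i n w].

Definition jhist (s : nat) (p : nat -> st) : set T :=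
  [set w | forall k, (k <= s)%N -> state k w = p k].

Lemma jhistE s p :
  jhist s p = \bigcap_(i in [set` [set: I]%SET]) history (C i) s (fun k => p k i).
Proof.
apply/seteqP; split => w.
  by move=> h i _ k ks; rewrite -(h k ks) ffunE.
by move=> h k ks; apply/ffunP => i; rewrite ffunE; apply: h => //=; rewrite inE.
Qed.

Let mC i : vertex_process (C i). Proof. by case: (hC i). Qed.

Lemma measurable_jhist s p : measurable (jhist s p).
Proof.
rewrite jhistE; apply: fin_bigcap_measurable => //.
by move=> i _; exact: measurable_history.
Qed.

(** States are countable: the event is a union over their codes, with the empty set at codes of no
    state in [B]. *)
Lemma measurable_state n (B : st -> bool) : measurable [set w | B (state n w)].
Proof.
pose F k : set T := if @unpickle st k is Some z then
  if B z then [set w | state n w = z] else set0 else set0.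
rewrite (_ : [set w | _] = \bigcup_k F k).
  apply: bigcup_measurable => k _; rewrite /F; case: unpickle => // z.
  case: ifP => // _.
  rewrite (_ : [set w | _] = \bigcap_(i in [set: I]) (C i n @^-1` [set z i])).
    by apply: fin_bigcap_measurable => // i _; exact: mC.
  apply/seteqP; split => w /=; first by move=> <- i _; rewrite /= ffunE.
  by move=> h; apply/ffunP => i; rewrite ffunE h.
apply/seteqP; split => w /=.
  by move=> Bw; exists (pickle (state n w)) => //; rewrite /F pickleK Bw.
by move=> [k _]; rewrite /F; case: unpickle => // z; case: ifP => // Bz /= ->.
Qed.

Definition event (B : nat -> st -> bool) (s n : nat) : set T :=
  [set w | forall k, (k <= n)%N -> B k (state (s + k) w)].

Lemma measurable_event B s n : measurable (event B s n).
Proof.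
rewrite (_ : event B s n =
  \bigcap_(k in [set k | (k <= n)%N]) [set w | B k (state (s + k) w)]) //.
by apply: bigcap_measurableType => k _; exact: measurable_state.
Qed.

Lemma pr_jhist s p :
  pr P (jhist s p) = \prod_i pr P (history (C i) s (fun k => p k i)).
Proof.
apply: EFin_inj; rewrite -prE; last exact: measurable_jhist.
rewrite jhistE hind => [|i _]; last exact: process_sigma_history.
rewrite -prodEFin; apply: eq_big => [i|i _]; first by rewrite inE.
by rewrite prE//; exact: measurable_history.
Qed.

Lemma pr_jhist_step s p : pr P (jhist s.+1 p) =
  pr P (jhist s p) * \prod_i comb_step R (p s i) (p s.+1 i).
Proof.
rewrite !pr_jhist -big_split; apply: eq_bigr => i _ /=.
exact: (pr_history_step s (fun k => p k i) (hC i)).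
Qed.

(** Markov property of the joint walk. The induction splits a history according to the next joint
    move; the path [p] varies because the move extends it. *)
Lemma pr_stay n s p B :
  pr P (jhist s p `&` event B s n) = pr P (jhist s p) * stay Q B n (p s).
Proof.
elim: n s p B => [|n IH] s p B.
  have Ew w : jhist s p w -> event B s 0 w = B 0%N (p s).
    move=> h; rewrite -(h s (leqnn s)); apply/propext; split.
      by move=> /(_ 0%N); rewrite addn0; apply.
    by move=> h0 k; rewrite leqn0 => /eqP ->; rewrite addn0.
  rewrite /=; case: (boolP (B 0%N (p s))) => Bp.
    rewrite mulr1; congr pr; apply/seteqP; split => w; first by case.
    by move=> h; split => //; rewrite Ew.
  rewrite mulr0 (_ : _ `&` _ = set0) ?/pr ?measure0//.
  by apply/seteqP; split => // w [h]; rewrite (Ew w h) (negbTE Bp).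
pose B' k := B k.+1.
have Ew w : jhist s p w -> event B s n.+1 w = (B 0%N (p s) /\ event B' s.+1 n w).
  move=> h; rewrite -(h s (leqnn s)); apply/propext; split.
    move=> hB; split; first by have := hB 0%N; rewrite addn0; apply.
    by move=> k kn; have := hB k.+1; rewrite addSnnS; apply.
  move=> [h0 h1] [|k] kn; first by rewrite addn0.
  by rewrite -addSnnS; apply: h1.
rewrite /=; case: (boolP (B 0%N (p s))) => Bp; last first.
  rewrite mul0r mulr0 (_ : _ `&` _ = set0) ?/pr ?measure0//.
  by apply/seteqP; split => // w [h]; rewrite (Ew w h) (negbTE Bp) => -[].
rewrite mul1r.
pose q (e : chain_move Q) k := if (k <= s)%N then p k else chain_next (p s) e.
have qs e : q e s = p s by rewrite /q leqnn.
have qS e : q e s.+1 = chain_next (p s) e by rewrite /q ltnn.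
have jq e : jhist s (q e) = jhist s p.
  by apply/seteqP; split => w h k ks; have := h k ks; rewrite /q ks.
have prq e : pr P (jhist s.+1 (q e)) = pr P (jhist s p) * chain_prob (p s) e.
  rewrite pr_jhist_step jq; congr (_ * _); apply: eq_bigr => i _.
  by rewrite qs qS /= ffunE comb_step_next.
have subH e : jhist s.+1 (q e) `<=` jhist s p.
  by rewrite -(jq e) => w h k ks; exact/h/leqW.
have inj e e' w : jhist s.+1 (q e) w -> jhist s.+1 (q e') w -> e = e'.
  move=> /(_ s.+1 (leqnn _)) + /(_ s.+1 (leqnn _)) => ->.
  rewrite !qS => /ffunP h; apply/ffunP => i; have := h i; rewrite !ffunE.
  exact: comb_next_inj.
have mH := measurable_jhist.
(* Disjointness of the extended histories gives only an inequality, as they may miss a null part of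
   [jhist s p]. Applied to the event and to its complement it becomes an equality, since the totals
   agree. *)
have le G : measurable G ->
    \sum_e pr P (jhist s.+1 (q e) `&` G) <= pr P (jhist s p `&` G).
  move=> mG; have := @pr_comb_le _ _ _ P _ unit (index_enum _) [:: tt] (fun=> 1)
    (fun=> 1) (fun e => jhist s.+1 (q e) `&` G) (fun=> jhist s p `&` G).
  rewrite big_seq1 mul1r.
  under eq_bigr do rewrite mul1r.
  apply => [e|_|w]; [exact: measurableI|exact: measurableI|].
  rewrite big_seq1 mul1r.
  under eq_bigr do rewrite mul1r.
  have [[e [he Gw]]|no] := pselect (exists e, (jhist s.+1 (q e) `&` G) w).
    rewrite (bigD1 e)//= big1 ?addr0 => [|e' ne].
      rewrite !indicE !mem_set//; split => //; exact: subH he.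
    rewrite indicE memNset// => -[he' _].
    by move: ne; rewrite (inj _ _ _ he he') eqxx.
  rewrite big1 ?indicE ?ler0n// => e _; rewrite indicE memNset// => h.
  by apply: no; exists e.
have mE := measurable_event B' s.+1 n.
have l1 := le _ mE; have l2 := le _ (measurableC mE).
have tot : \sum_e pr P (jhist s.+1 (q e)) = pr P (jhist s p).
  under eq_bigr do rewrite prq.
  by rewrite -mulr_sumr chain_prob_sum mulr1.
have splt := prIC P (mH s p) mE.
have : \sum_e pr P (jhist s.+1 (q e)) =
    \sum_e pr P (jhist s.+1 (q e) `&` event B' s.+1 n) +
    \sum_e pr P (jhist s.+1 (q e) `&` ~` event B' s.+1 n).
  by rewrite -big_split; apply: eq_bigr => e _; rewrite /= prIC.
rewrite tot => tot2.
have -> : jhist s p `&` event B s n.+1 = jhist s p `&` event B' s.+1 n.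
  apply/seteqP; split => w [h1 h2]; split => //; move: h2; rewrite (Ew w h1).
    by case.
  by [].
have -> : pr P (jhist s p `&` event B' s.+1 n) =
    \sum_e pr P (jhist s.+1 (q e) `&` event B' s.+1 n) by lra.
rewrite /avg mulr_sumr; apply: eq_bigr => e _.
by rewrite IH prq qS mulrA.
Qed.

Lemma pr_start : pr P [set w | state 0 w = start] = 1.
Proof.
have -> : [set w | state 0 w = start] = jhist 0 (fun=> start).
  apply/seteqP; split => w /=; last exact.
  by move=> h k; rewrite leqn0 => /eqP ->.
rewrite pr_jhist big1// => i _.
have -> : history (C i) 0 (fun=> start i) = [set w | C i 0%N w = origin].
  apply/seteqP; split => w /=; first by move=> /(_ 0%N (leqnn _)); rewrite ffunE.
  by move=> h k; rewrite leqn0 => /eqP ->; rewrite ffunE.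
by case: (hC i) => _ h _; rewrite /pr h.
Qed.

Lemma pr_event B n : pr P (event B 0 n) = stay Q B n start.
Proof.
have jE : jhist 0 (fun=> start) = [set w | state 0 w = start].
  apply/seteqP; split => w /=; first by move=> /(_ 0%N (leqnn _)).
  by move=> h k; rewrite leqn0 => /eqP ->.
have := pr_stay n 0 (fun=> start) B; rewrite jE pr_start mul1r => <-.
rewrite setIC pr_setI1 ?pr_start//; first exact: measurable_event.
by rewrite -jE; exact: measurable_jhist.
Qed.

End walks.

Section stay_bounds.
Variables (R : realType) (S : Type) (c : chain R S).
Implicit Types (A : S -> bool) (z : S).

(** A constraint that is vacuous except at time [m] puts a one-time event into the form handled by
    [pr_event]. *)
Lemma stay_at A m z :
  stay c (fun k z => (k != m) || A z) m z = avgn c m (fun z => (A z)%:R) z.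
Proof.
elim: m z => [//|m IH] z; rewrite avgnS /= mul1r; congr avg.
by apply/funext => y; rewrite -IH.
Qed.

Lemma stay_at2_le A A' m j k z :
  (forall y, avgn c j (fun y => (A' y)%:R) y <= k) ->
  stay c (fun i y => ((i != m) || A y) && ((i != m + j)%N || A' y)) (m + j) z <=
  k * avgn c m (fun y => (A y)%:R) z.
Proof.
move=> hk; elim: m z => [|m IH] z; last first.
  rewrite avgnS addSn /= mul1r -avg_scale; apply: avg_le => y; exact: IH.
case: j hk => [|j] hk /=.
  by have := hk z; rewrite /avgn /=; case: (A z); case: (A' z) => /=; lra.
rewrite andbT mulrC ler_wpM2r ?ler0n//.
have := hk z; rewrite avgnS; apply: le_trans; rewrite le_eqVlt; apply/orP; left.
apply/eqP; congr avg; apply/funext => y; rewrite -stay_at.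
by congr stay.
Qed.

(** Here [n] in [h n] is the time left. By induction [h n] dominates the probability of meeting [A]
    within [n] steps; the first [s] steps, during which visits do not count, only average it. *)
Lemma stay_hit_le A s n (h : nat -> S -> R) z :
  (forall n z, (A z)%:R <= h n z) ->
  (forall n z, avg c (h n) z <= h n.+1 z) ->
  1 - stay c (fun k z => (k < s)%N || ~~ A z) (s + n) z <= avgn c s (h n) z.
Proof.
move=> hA hQ.
have hit m y : 1 - stay c (fun k z => ~~ A z) m y <= h m y.
  elim: m y => [|m IH] y /=; first by have := hA 0%N y; case: (A y) => /=; lra.
  case: (boolP (A y)) => Ay /=; first by have := hA m.+1 y; rewrite Ay /=; lra.
  apply: le_trans (hQ m y); rewrite mul1r.
  rewrite -[X in X - _](avg_cst c 1 y) lerBlDr -avg_add; apply: avg_le => x.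
  by have := IH x; lra.
elim: s z => [|s IH] z; first exact: hit.
rewrite avgnS addSn /= mul1r.
rewrite -[X in X - _](avg_cst c 1 z) lerBlDr -avg_add; apply: avg_le => x.
by have := IH x; rewrite lerBlDr; apply.
Qed.

End stay_bounds.

Section walk_bounds.
Context (d : measure_display) (T : measurableType d) (R : realType).
Variables (P : probability T R) (I : finType) (C : I -> nat -> T -> vertex).
Hypothesis hC : forall i, comb_random_walk P (C i).
Hypothesis hind : independent_processes P C.

Local Notation st := {ffun I -> vertex}.
Local Notation Q := (prod_chain (comb_chain R) I).

Lemma pr_state (A : st -> bool) m :
  pr P [set w | A (state C m w)] = avgn Q m (fun z => (A z)%:R) (start I).
Proof.
rewrite -stay_at -(pr_event hC hind); congr pr; apply/seteqP; split => w /=.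
  by move=> Aw k _; rewrite add0n; case: eqP => //= ->.
by move=> /(_ m (leqnn m)); rewrite eqxx.
Qed.

Lemma pr_state2_le (A A' : st -> bool) m j k :
  (forall z, avgn Q j (fun z => (A' z)%:R) z <= k) ->
  pr P [set w | A (state C m w) && A' (state C (m + j) w)] <=
  k * pr P [set w | A (state C m w)].
Proof.
move=> hk; have := stay_at2_le A m (start I) hk; rewrite -(pr_event hC hind) -pr_state.
apply: le_trans; rewrite le_eqVlt; apply/orP; left; apply/eqP; congr pr.
apply/seteqP; split => w /=.
  by move=> /andP[h1 h2] i _; rewrite add0n; apply/andP; split; case: eqP => //= ->.
move=> h; have := h m (leq_addr _ _); have := h _ (leqnn (m + j)).
by rewrite !add0n !eqxx /= => /andP[_ ->] /andP[->].
Qed.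

Lemma measurable_hit (A : st -> bool) s t :
  measurable [set w | exists k, (s <= k <= t)%N /\ A (state C k w)].
Proof.
rewrite (_ : [set w | _] = \bigcup_(k in [set k | (s <= k <= t)%N])
    [set w | A (state C k w)]).
  by apply: bigcup_measurable => k _; exact: measurable_state.
by apply/seteqP; split => w [k]; [move=> []; exists k|exists k].
Qed.

Lemma pr_hit_le (A : st -> bool) s n (h : nat -> st -> R) :
  (forall n z, (A z)%:R <= h n z) ->
  (forall n z, avg Q (h n) z <= h n.+1 z) ->
  pr P [set w | exists k, (s <= k <= s + n)%N /\ A (state C k w)] <=
  avgn Q s (h n) (start I).
Proof.
move=> hA hQ; apply: le_trans (stay_hit_le s n (start I) hA hQ).
rewrite -(pr_event hC hind) -prC; last exact: measurable_event.
rewrite le_eqVlt; apply/orP; left; apply/eqP; congr pr.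
apply/seteqP; split => w /=.
  move=> [k [/andP[sk kn] Ak]] /(_ k kn); rewrite add0n Ak orbF.
  by rewrite ltnNge sk.
move=> h1; apply: contrapT => h2; apply: h1 => k kn; rewrite add0n.
case: ltnP => //= sk; apply/negP => Ak; apply: h2; exists k.
by rewrite sk kn.
Qed.

End walk_bounds.

(** * Occupation of neighbourhoods of the axis *)

Section low_sets.
Variables (R : realType) (I : finType).

Local Notation st := {ffun I -> vertex}.
Local Notation Q := (prod_chain (comb_chain R) I).
Local Notation fw := (folded_walk R).

Definition low (r : nat) (z : st) : bool := [forall i, (`|(z i).2| <= r)%N].

Lemma low_prod r z : (low r z)%:R = \prod_i fwball R r `|(z i).2|%N.
Proof.
rewrite /low /fwball; case: forallP => [h|nh].
  by rewrite big1// => i _; rewrite h.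
case: (boolP [exists i, ~~ (`|(z i).2| <= r)%N]) => [/existsP[i hi]|].
  by rewrite (bigD1 i)//= (negbTE hi) mul0r.
rewrite negb_exists => /forallP h; case: nh => i.
by have := h i; rewrite negbK.
Qed.

Lemma avgn_low n r z :
  avgn Q n (fun z => (low r z)%:R) z = \prod_i avgn fw n (fwball R r) `|(z i).2|%N.
Proof.
rewrite (_ : (fun z => _) =
    fun z : st => \prod_i (fun v : vertex => fwball R r `|v.2|%N) (z i)); last first.
  by apply/funext => y; rewrite low_prod.
rewrite (@avgn_prod _ _ _ _ n (fun i (v : vertex) => fwball R r `|v.2|%N)).
by apply: eq_bigr => i _; rewrite avgn_comb_height.
Qed.

Lemma avgn_low_le n r z :
  avgn Q n (fun z => (low r z)%:R) z <= (r.+1%:R * fwret R n) ^+ #|I|.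
Proof.
rewrite avgn_low -prodr_const; apply: ler_prod => i _.
by rewrite folded_ball_le avgn_ge0// => s; rewrite ler0n.
Qed.

Lemma avgn_low_le_sqrt n r z : (0 < n)%N ->
  avgn Q n (fun z => (low r z)%:R) z <= (2 * r.+1%:R / Num.sqrt n%:R) ^+ #|I|.
Proof.
move=> n0; apply: le_trans (avgn_low_le n r z) _.
rewrite lerXn2r ?nnegrE ?mulr_ge0 ?fwret_ge0 ?invr_ge0 ?sqrtr_ge0 ?ler0n//.
rewrite ler_pdivlMr ?sqrtr_gt0 ?ltr0n// -mulrA mulrC.
by rewrite ler_wpM2r ?ler0n// fwret_le.
Qed.

Lemma avgn_low_ge n r : (0 < n)%N -> r%:R <= 2 * Num.sqrt n%:R :> R ->
  (r.+1%:R / (6 * Num.sqrt n%:R)) ^+ #|I| <=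
  avgn Q n (fun z => (low r z)%:R) (start I).
Proof.
move=> n0 rn; rewrite avgn_low -prodr_const; apply: ler_prod => i _.
rewrite divr_ge0 ?mulr_ge0 ?sqrtr_ge0//= ffunE /=.
rewrite ler_pdivrMr ?mulr_gt0 ?sqrtr_gt0 ?ltr0n//.
by rewrite mulrC; exact: folded_ball_ge.
Qed.

(** Chebyshev: the second moment is at most s^2 + m <= 2 r^2, which is at most half of (2 r +
    1)^2. *)
Lemma folded_stay_ge r s m : (s <= r)%N -> (m <= r ^ 2)%N ->
  2^-1 <= avgn fw m (fwball R (2 * r)%N) s.
Proof.
move=> sr mr; set l : R := (2 * r)%N.+1%:R.
have l0 : 0 < l ^+ 2 by rewrite exprn_gt0 ?ltr0n.
have kl : (l ^+ 2)^-1 * l ^+ 2 = 1 by rewrite mulVf ?gt_eqF.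
have : 0 < (l ^+ 2)^-1 by rewrite invr_gt0.
move: kl; set k := _^-1 => kl k0.
have : avgn fw m (fun s => 1 + - k * s%:R ^+ 2) s <=
    avgn fw m (fwball R (2 * r)%N) s.
  apply: avgn_le => t; rewrite /fwball; have [_|rt] := leqP t (2 * r)%N.
    by have := mulr_ge0 (ltW k0) (sqr_ge0 (t%:R : R)); rewrite /=; lra.
  have : l ^+ 2 <= t%:R ^+ 2 by rewrite lerXn2r ?nnegrE ?ler0n// ler_nat.
  by rewrite -(ler_pM2l k0) kl /=; lra.
rewrite avgn_add avgn_cst avgn_scale; apply: le_trans.
suff : k * avgn fw m (fun s => s%:R ^+ 2) s <= 2^-1 by lra.
apply: le_trans (_ : k * (l ^+ 2 / 2) <= _); last by rewrite mulrA kl mul1r.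
rewrite ler_wpM2l ?(ltW k0)//; apply: le_trans (folded_sqr R m s) _.
have -> : l ^+ 2 = ((2 * r).+1 ^ 2)%N%:R by rewrite natrX.
rewrite -natrX -natrD ler_pdivlMr// -natrM ler_nat; nia.
Qed.

Lemma low_stay_ge r z m : low r z -> (m <= r ^ 2)%N ->
  (2^-1) ^+ #|I| <= avgn Q m (fun z => (low (2 * r)%N z)%:R) z.
Proof.
move=> /forallP lz mr; rewrite avgn_low -prodr_const; apply: ler_prod => i _.
by rewrite invr_ge0 ler0n; exact: folded_stay_ge.
Qed.

End low_sets.

Section low_hit.
Context (d : measure_display) (T : measurableType d) (R : realType).
Variables (P : probability T R) (I : finType) (C : I -> nat -> T -> vertex).
Hypothesis hC : forall i, comb_random_walk P (C i).
Hypothesis hind : independent_processes P C.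

Local Notation st := {ffun I -> vertex}.
Local Notation Q := (prod_chain (comb_chain R) I).

(* Once in [low r], the walk spends a time of order [r ^ 2] in [low (2 * r)],
   so the hitting probability is at most the expected occupation time of
   [low (2 * r)] divided by [r ^ 2]. *)
Lemma pr_low_hit_le r s n : (0 < s)%N ->
  pr P [set w | exists k, (s <= k <= s + n)%N /\ low r (state C k w)] <=
  2 ^+ #|I| / (r ^ 2)%N.+1%:R *
  (\sum_(m < n + (r ^ 2)%N.+1) (2 * (2 * r)%N.+1%:R / Num.sqrt s%:R) ^+ #|I|).
Proof.
move=> s0; set t := (r ^ 2)%N.+1.
pose f : st -> R := fun z => (low (2 * r)%N z)%:R.
have f0 m z : 0 <= avgn Q m f z by apply: avgn_ge0 => y; rewrite ler0n.
set k := 2 ^+ #|I| / t%:R.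
have k0 : 0 <= k by rewrite divr_ge0 ?exprn_ge0 ?ler0n.
(* The horizon exceeds the time left by [t], so that even a hit at the last moment is followed by
   [t] times, each spent in [low (2 * r)] with probability at least 2^(-#|I|); [k] normalizes this
   to 1. *)
pose h n z := k * \sum_(m < n + t) avgn Q m f z.
apply: le_trans (pr_hit_le hC hind (h := h) (A := low r) s n _ _) _.
- move=> {}n z; rewrite /h; case: (boolP (low r z)) => lz; last first.
    by apply: mulr_ge0 => //; apply: sumr_ge0 => m _.
  apply: (@le_trans _ _ (k * \sum_(m < t) avgn Q m f z)); last first.
    by rewrite ler_wpM2l// addnC big_split_ord lerDl; apply: sumr_ge0 => m _.
  apply: (@le_trans _ _ (k * \sum_(m < t) (2^-1) ^+ #|I|)).
    rewrite sumr_const card_ord -[X in k * X]mulr_natr /k mulrA (mulrAC _ t%:R^-1).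
    by rewrite -exprMn divff ?pnatr_eq0// expr1n mul1r mulVf ?pnatr_eq0.
  rewrite ler_wpM2l//; apply: ler_sum => m _; apply: low_stay_ge => //.
  by have := ltn_ord m; rewrite ltnS.
- move=> {}n z; rewrite /h avg_scale ler_wpM2l// avg_sum.
  rewrite addSn big_ord_recl /= lerDr; exact: f0.
rewrite /h avgn_scale ler_wpM2l// avgn_sum; apply: ler_sum => m _.
rewrite -avgnD.
have sm : (0 < s + m)%N by rewrite addn_gt0 s0.
apply: le_trans (avgn_low_le_sqrt R (2 * r)%N (start I) sm) _.
rewrite lerXn2r ?nnegrE ?divr_ge0 ?sqrtr_ge0 ?mulr_ge0 ?ler0n//.
rewrite ler_wpM2l ?mulr_ge0 ?ler0n// lef_pV2 ?posrE ?sqrtr_gt0 ?ltr0n ?addn_gt0 ?s0//.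
by rewrite ler_sqrt ?ler0n// ler_nat leq_addr.
Qed.

End low_hit.

(** * Horizontal coordinates *)

Section horizontal.
Variable R : realType.
Local Notation cc := (comb_chain R).

Lemma comb_sqr_submgn n v :
  (v.1%:~R : R) ^+ 2 <= avgn cc n (fun v => (v.1%:~R : R) ^+ 2) v.
Proof.
elim: n => [//|n IH]; rewrite avgnSr; apply: le_trans IH _.
by apply: avgn_le => u; exact: comb_sqr_submg.
Qed.

(** A convex function whose second difference is 2 on the window |x| <= 2 and 0 outside. The window
    has radius 2 because each of two walkers shifts by at most 1, so only such pairs can share a
    tooth one step later. *)
Definition spread (x : int) : nat :=
  (absz (x - 2)%R + absz (x - 1)%R + absz x + absz (x + 1)%R + absz (x + 2)%R)%N.

Lemma spread_drift x :
  (spread (x + 1) + spread (x - 1) = 2 * spread x + 2 * (absz x <= 2))%N.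
Proof. rewrite /spread; lia. Qed.

Lemma spread_driftR x : (spread (x + 1))%:R + (spread (x - 1))%:R =
  2 * (spread x)%:R + 2 * (absz x <= 2)%N%:R :> R.
Proof. by rewrite -natrD spread_drift natrD !natrM. Qed.

Let dspread (u v : vertex) : R := (spread (u.1 - v.1))%:R.

Let close (u v : vertex) : R := (absz (u.1 - v.1)%R <= 2)%N%:R.

Lemma avg_spread_r u v :
  avg cc (dspread u) v = dspread u v + 2^-1 * ((v.2 == 0)%:R * close u v).
Proof.
case: v => x y /=; have [->|y0] := eqVneq y 0.
  rewrite avg_comb_axis /dspread /close /= mul1r.
  have := spread_driftR (u.1 - x).
  have -> : u.1 - x + 1 = u.1 - (x - 1) by ring.
  have -> : u.1 - x - 1 = u.1 - (x + 1) by ring.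
  lra.
by rewrite avg_comb_tooth// /dspread /= mul0r; lra.
Qed.

Lemma avg_spread_l u v :
  avg cc (fun u => dspread u v) u = dspread u v + 2^-1 * ((u.2 == 0)%:R * close u v).
Proof.
have E a b : dspread a b = dspread b a by rewrite /dspread /spread; congr (_%:R); lia.
have -> : close u v = close v u by rewrite /close; congr (_%:R); lia.
rewrite (_ : (fun u => _) = dspread v) ?avg_spread_r; first by rewrite E.
by apply/funext => a; rewrite E.
Qed.

Definition near_axis (u v : vertex) : bool :=
  ((u.2 == 0) || (v.2 == 0)) && (absz (u.1 - v.1)%R <= 2)%N.

(** A walker on the axis moves horizontally with probability 1/2, which gives a drift of 1/2 within
    the window; convexity keeps the other contribution nonnegative. The growth of the mean spread
    thus counts the visits to [near_axis]. *)
Lemma avg_spread u v :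
  dspread u v + 2^-1 * (near_axis u v)%:R <=
  avg cc (fun u => avg cc (dspread u) v) u.
Proof.
have c0 a : 0 <= close a v by rewrite ler0n.
rewrite (_ : (fun u => _) = fun u =>
    dspread u v + 2^-1 * ((v.2 == 0)%:R * close u v)); last first.
  by apply/funext => a; rewrite avg_spread_r.
rewrite avg_add avg_spread_l !avg_scale /near_axis.
have a0 : 0 <= avg cc (close^~ v) u.
  by rewrite -[leLHS](avg_cst cc 0 u); apply: avg_le.
have cE : close u v = (absz (u.1 - v.1)%R <= 2)%N%:R by [].
have [u0|u0] := eqVneq u.2 0; rewrite /= mul1r || rewrite /= mul0r.
  by rewrite -cE; case: (v.2 == 0) => /=; lra.
have [v0|v0] := eqVneq v.2 0; rewrite /= ?mul1r ?mul0r ?addr0; last by lra.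
suff -> : avg cc (close^~ v) u = close u v by rewrite -cE; lra.
by move: u0 {a0 cE}; case: u => x y /= y0; rewrite avg_comb_tooth// /close /=; lra.
Qed.

(** By gambler's ruin, y / r is the probability of climbing from y to r before reaching the axis;
    the minimum bounds the chance that both walkers do so in a common tooth. *)
Let touch (r : nat) (u v : vertex) : R :=
  if u.1 == v.1 then Num.min 1 (Num.min (`|u.2|%:R / r%:R) (`|v.2|%:R / r%:R))
  else 0.

Lemma touch_le r u v :
  [/\ 0 <= touch r u v, touch r u v <= 1, touch r u v <= `|u.2|%:R / r%:R &
      touch r u v <= `|v.2|%:R / r%:R].
Proof.
have h (n : nat) : 0 <= n%:R / r%:R :> R by rewrite divr_ge0 ?ler0n.
rewrite /touch; case: ifP => _; last by split.
by split; rewrite ?le_min ?ge_min ?h ?lexx ?ler01 ?orbT.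
Qed.

Lemma avg_height s v : avg cc (fun v => `|v.2|%:R / s) v =
  (`|v.2|%:R + 2^-1 * (v.2 == 0)%:R) / s.
Proof.
rewrite (avg_comb_height (fun n => n%:R / s)) avg_folded.
rewrite -absz_eq0; case: absz => [|n] /=; first by lra.
by rewrite -(@natr1 R n) -(@natr1 R n.+1) -(@natr1 R n) -!mulrDl mulrAC; congr (_ / _); lra.
Qed.

Lemma comb_next_shift v e : (absz ((comb_next v e).1 - v.1)%R <= 1)%N.
Proof. by case: v e => x y [[] []] /=; lia. Qed.

(** Off the axis each height is a martingale, and the mean of a minimum is at most the minimum of
    the means. A walker on the axis has mean height 1/2 after one step, which costs at most 1 / r;
    walkers off the axis in different teeth, or more than 2 apart, cannot share a tooth after one
    step. *)
Lemma avg_touch r u v : (0 < r)%N ->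
  avg cc (fun u => avg cc (touch r u) v) u <=
  touch r u v + r%:R^-1 * (near_axis u v)%:R.
Proof.
move=> r0; have tr0 a b : 0 <= touch r a b by case: (touch_le r a b).
have r0' : 0 < r%:R^-1 :> R by rewrite invr_gt0 ltr0n.
have bu : avg cc (fun u => avg cc (touch r u) v) u <=
    (`|u.2|%:R + 2^-1 * (u.2 == 0)%:R) / r%:R.
  rewrite -avg_height; apply: avg_le => a.
  rewrite -[leRHS](avg_cst cc _ v); apply: avg_le => b.
  by case: (touch_le r a b).
have bv : avg cc (fun u => avg cc (touch r u) v) u <=
    (`|v.2|%:R + 2^-1 * (v.2 == 0)%:R) / r%:R.
  rewrite -[leRHS](avg_cst cc _ u); apply: avg_le => a.
  by rewrite -avg_height; apply: avg_le => b; case: (touch_le r a b).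
have b1 : avg cc (fun u => avg cc (touch r u) v) u <= 1.
  rewrite -[leRHS](avg_cst cc _ u); apply: avg_le => a.
  rewrite -[leRHS](avg_cst cc _ v); apply: avg_le => b.
  by case: (touch_le r a b).
have [far|cl] := ltnP 2 (absz (u.1 - v.1)%R).
  apply: (@le_trans _ _ 0); last first.
    by rewrite addr_ge0// mulr_ge0 ?ler0n// ltW.
  apply: avg_le_near => e _; apply: avg_le_near => e' _ /=.
  rewrite /touch ifF//; apply/negbTE/eqP.
  have := comb_next_shift u e; have := comb_next_shift v e'; lia.
rewrite /near_axis cl andbT.
have [u0|u0] := eqVneq u.2 0.
  apply: le_trans bu _; rewrite u0 eqxx /= !mulr1 add0r.
  by rewrite ler_wpDl// ler_piMl ?(ltW r0')//; lra.
have [v0|v0] := eqVneq v.2 0.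
  apply: le_trans bv _; rewrite v0 eqxx /= !mulr1 add0r.
  by rewrite ler_wpDl// ler_piMl ?(ltW r0')//; lra.
rewrite /= mulr0 addr0; rewrite (negbTE u0) mulr0 addr0 in bu.
rewrite (negbTE v0) mulr0 addr0 in bv.
have [uv|uv] := eqVneq u.1 v.1.
  by rewrite [leRHS]/touch uv eqxx !le_min b1 bu bv.
rewrite le_eqVlt [X in X == _](_ : _ = 0) ?[touch r u v]/touch ?(negbTE uv) ?eqxx//.
move: u0 v0 uv; case: u {bu bv b1 cl} => x y; case: v => x' y' /= y0 y0' xx'.
by rewrite !avg_comb_tooth// /touch /= (negbTE xx'); lra.
Qed.

Section pair.
Variables (I : finType) (i j : I).
Hypothesis ij : i != j.

Local Notation st := {ffun I -> vertex}.
Local Notation Q := (prod_chain (comb_chain R) I).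

(** Each visit adds 1/2 to the mean spread, which starts at 6 and is at most 5 (l + sqrt n / l) + 6.
    The bound on the mean comes from |x| <= l / 2 + x^2 / (2 l) and E x^2 <= sqrt n; the best choice
    of l is of order n^(1/4). *)
Lemma near_axis_visits n (l : R) : 0 < l ->
  \sum_(k < n) avgn Q k (fun z : st => (near_axis (z i) (z j))%:R) (start I) <=
  10 * (l + Num.sqrt n%:R / l).
Proof.
move=> l0; pose f (z : st) := dspread (z i) (z j).
have cnt : \sum_(k < n) avgn Q k (fun z => 2^-1 * (near_axis (z i) (z j))%:R) (start I)
    <= avgn Q n f (start I) - f (start I).
  apply: avgn_count => z.
  by rewrite (avg_coord2 _ dspread z ij); exact: avg_spread.
have E k : avgn Q k (fun z => 2^-1 * (near_axis (z i) (z j))%:R) (start I) =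
    2^-1 * avgn Q k (fun z => (near_axis (z i) (z j))%:R) (start I).
  by rewrite avgn_scale.
rewrite (eq_bigr _ (fun (k : 'I_n) _ => E k)) -mulr_sumr in cnt.
suff : avgn Q n f (start I) <= 5 * (l + Num.sqrt n%:R / l) + 6.
  have f6 : f (start I) = 6 by rewrite /f /dspread !ffunE /spread.
  by move: cnt; rewrite f6; set s := \sum_(_ < _) _; lra.
pose sq (v : vertex) : R := v.1%:~R ^+ 2.
have bnd k : avgn Q n (fun z => sq (z k)) (start I) <= Num.sqrt n%:R.
  by rewrite (@avgn_coord _ _ _ _ n k sq) ffunE; exact: comb_sqr_le.
have a1 (t : int) : (absz t)%:R <= 2^-1 * l + (2 * l)^-1 * (t%:~R) ^+ 2 :> R.
  have -> : (t%:~R : R) ^+ 2 = (absz t)%:R ^+ 2.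
    by rewrite natr_absz intr_norm real_normK ?num_real.
  set s : R := (absz t)%:R; have := sqr_ge0 (s - l).
  rewrite -(ler_pM2l (_ : 0 < (2 * l)^-1)) ?invr_gt0 ?mulr_gt0// mulr0.
  have -> : (2 * l)^-1 * (s - l) ^+ 2 = (2 * l)^-1 * s ^+ 2 + 2^-1 * l - s.
    by field; rewrite gt_eqF.
  lra.
apply: (@le_trans _ _ (avgn Q n (fun z => (5 * l + 6) +
    (5 * (2 * l)^-1) * (sq (z i) + sq (z j))) (start I))).
  apply: avgn_le => z; rewrite /f /dspread /sq.
  move: (z i).1 (z j).1 => x y {cnt E bnd}.
  have s1 : (spread (x - y) <= 5 * (absz x + absz y) + 6)%N by rewrite /spread; lia.
  have : (spread (x - y))%:R <= 5 * ((absz x)%:R + (absz y)%:R) + 6 :> R.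
    by rewrite -natrD -natrM -natrD ler_nat.
  have := a1 x; have := a1 y; rewrite mulrDr -!mulrA; lra.
rewrite avgn_add avgn_cst avgn_scale avgn_add.
have := bnd i; have := bnd j; set p := avgn _ _ _ _; set q := avgn _ _ _ _ => hp hq.
have : (2 * l)^-1 * (q + p) <= (2 * l)^-1 * (2 * Num.sqrt n%:R).
  by rewrite ler_wpM2l ?invr_ge0 ?mulr_ge0 ?(ltW l0)//; lra.
have -> : (2 * l)^-1 * (2 * Num.sqrt n%:R) = Num.sqrt n%:R / l.
  by field; rewrite gt_eqF.
rewrite -mulrA; lra.
Qed.

Definition meet (r : nat) (z : st) : bool :=
  [&& (z i).1 == (z j).1, (r <= `|(z i).2|)%N & (r <= `|(z j).2|)%N].

Context (d : measure_display) (T : measurableType d).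
Variables (P : probability T R) (C : I -> nat -> T -> vertex).
Hypothesis hC : forall i, comb_random_walk P (C i).
Hypothesis hind : independent_processes P C.

(* Two walkers in the same tooth, both at height [r], must have entered it from
   the axis, where each visit gives them a chance at most [1 / r]. *)
Lemma pr_meet_le r n (l : R) : (0 < r)%N -> 0 < l ->
  pr P [set w | exists k, (0 <= k <= 0 + n)%N /\ meet r (state C k w)] <=
  r%:R^-1 * (10 * (l + Num.sqrt n%:R / l)).
Proof.
move=> r0 l0; pose V (z : st) : R := (near_axis (z i) (z j))%:R.
have r0' : 0 < r%:R :> R by rewrite ltr0n.
have V0 k z : 0 <= avgn Q k V z by apply: avgn_ge0 => y; rewrite ler0n.
(* The expected number of remaining visits near the axis pays for the increments of [touch]
   there. *)
pose h n (z : st) := touch r (z i) (z j) + r%:R^-1 * \sum_(k < n) avgn Q k V z.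
have t0 a b : 0 <= touch r a b by case: (touch_le r a b).
apply: le_trans (pr_hit_le hC hind (h := h) (A := meet r) 0 n _ _) _.
- move=> m z; rewrite /h.
  have s0 : 0 <= r%:R^-1 * \sum_(k < m) avgn Q k V z.
    by rewrite mulr_ge0 ?invr_ge0 ?ler0n// sumr_ge0.
  case: (boolP (meet r z)) => [/and3P[xx yi yj]|_]; last by rewrite addr_ge0.
  rewrite /touch xx -[leLHS]addr0 lerD// !le_min lexx /=.
  by rewrite !ler_pdivlMr// !mul1r !ler_nat yi.
- move=> m z; rewrite /h avg_add avg_scale avg_sum big_ord_recl mulrDr addrA lerD//.
  by rewrite (avg_coord2 _ (touch r) z ij); exact: avg_touch.
rewrite /h /avgn /= -/(avgn _ _ _) /touch !ffunE eqxx /= mul0r.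
rewrite minxx min_r ?ler01// add0r ler_wpM2l ?invr_ge0 ?ler0n//.
exact: near_axis_visits.
Qed.


End pair.
End horizontal.

Section horizontal_max.
Context (d : measure_display) (T : measurableType d) (R : realType).
Variables (P : probability T R) (I : finType) (C : I -> nat -> T -> vertex).
Hypothesis hC : forall i, comb_random_walk P (C i).
Hypothesis hind : independent_processes P C.

Definition wide (i : I) (s : nat) (z : {ffun I -> vertex}) : bool :=
  (s <= `|(z i).1|)%N.

(** Doob's maximal inequality for the submartingale x^2. *)
Lemma pr_wide_le i s n : (0 < s)%N ->
  pr P [set w | exists k, (0 <= k <= 0 + n)%N /\ wide i s (state C k w)] <=
  Num.sqrt n%:R / s%:R ^+ 2.
Proof.
move=> s0; have s2 : 0 < (s%:R : R) ^+ 2 by rewrite exprn_gt0 ?ltr0n.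
pose sq (v : vertex) : R := v.1%:~R ^+ 2.
pose h n (z : {ffun I -> vertex}) := (s%:R ^+ 2)^-1 * avgn (comb_chain R) n sq (z i).
apply: le_trans (pr_hit_le hC hind (h := h) (A := wide i s) 0 n _ _) _.
- move=> m z; rewrite /h ler_pdivlMl//.
  apply: le_trans (comb_sqr_submgn R m (z i)).
  have -> : ((z i).1%:~R : R) ^+ 2 = (absz (z i).1)%:R ^+ 2.
    by rewrite natr_absz intr_norm real_normK ?num_real.
  rewrite /wide; case: leqP => sx /=; last by rewrite mulr0 sqr_ge0.
  by rewrite mulr1 lerXn2r ?nnegrE ?ler0n// ler_nat.
- move=> m z; rewrite /h avg_scale ler_wpM2l ?invr_ge0 ?(ltW s2)//.
  by rewrite (avg_coord _ i (avgn (comb_chain R) m sq)).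
rewrite /h /avgn /= -/(avgn _ _ _ _) ffunE mulrC ler_wpM2r ?invr_ge0 ?(ltW s2)//.
exact: comb_sqr_le.
Qed.

End horizontal_max.

(** * Graph distance *)

Lemma joined_axis_length (x : int) : joined_by origin (x, 0) (absz x).
Proof.
elim: x => [|n kn|n kn]; first by exists [::].
- rewrite -addn1; apply: joined_by_cat kn _; apply: joined_by_edge.
  by rewrite /comb_edge /lattice_edge /=; lia.
- have -> : absz (- n.+1%:Z) = (absz (- n%:Z) + 1)%N by lia.
  apply: joined_by_cat kn _; apply: joined_by_edge.
  by rewrite /comb_edge /lattice_edge /=; lia.
Qed.

Lemma joined_tooth_length (x y : int) : joined_by (x, 0) (x, y) (absz y).
Proof.
elim: y => [|n kn|n kn]; first by exists [::].
- rewrite -addn1; apply: joined_by_cat kn _; apply: joined_by_edge.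
  by rewrite /comb_edge /lattice_edge /=; lia.
- have -> : absz (- n.+1%:Z) = (absz (- n%:Z) + 1)%N by lia.
  apply: joined_by_cat kn _; apply: joined_by_edge.
  by rewrite /comb_edge /lattice_edge /=; lia.
Qed.

Lemma comb_dist_le u v :
  (comb_dist u v <= (absz u.1 + absz u.2) + (absz v.1 + absz v.2))%N.
Proof.
have H w : joined_by origin w (absz w.1 + absz w.2).
  by case: w => x y; apply: joined_by_cat (joined_axis_length x) _;
    exact: joined_tooth_length.
rewrite /comb_dist; case: ex_minnP => k _; apply.
by apply/asboolP; apply: joined_by_cat (H v); apply: joined_by_sym.
Qed.

Lemma comb_distP u v : joined_by u v (comb_dist u v).
Proof. by rewrite /comb_dist; case: ex_minnP => k /asboolP. Qed.

Lemma joined_height u v k : joined_by u v k -> (absz (u.2 - v.2)%R <= k)%N.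
Proof.
move=> [p []]; elim: p u k => [|z p IH] u k /=; first by move=> _ <- <-; lia.
move=> /andP[/andP[uz _] pz] lz <-; have := IH z _ pz lz erefl.
by move: uz; rewrite /lattice_edge => /eqP; lia.
Qed.

(** Teeth communicate only along the axis, so the path must descend one tooth and climb another. The
    induction follows vertical edges up to the first horizontal one, whose ends have height 0. *)
Lemma joined_teeth u v k : joined_by u v k -> u.1 != v.1 ->
  (absz u.2 + absz v.2 <= k)%N.
Proof.
move=> [p []]; elim: p u k => [|z p IH] u k /=; first by move=> _ <-; rewrite eqxx.
move=> /andP[uz pz] lz <- uv.
have [zu|zu] := eqVneq z.1 u.1.
  have := IH z _ pz lz erefl; rewrite zu => /(_ uv).
  by move: uz; rewrite /comb_edge /lattice_edge => /andP[/eqP h _]; lia.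
have : (absz (z.2 - v.2)%R <= size p)%N by apply: joined_height; exists p.
by move: uz; rewrite /comb_edge /lattice_edge => /andP[/eqP h]; lia.
Qed.

Section max_dist.
Context (d : measure_display) (T : measurableType d).
Variables (K : nat) (C : 'I_K -> nat -> T -> vertex).

Lemma comb_dist_max n w i j : i != j ->
  (comb_dist (C i n w) (C j n w) <= max_dist C n w)%N.
Proof.
move=> ij; rewrite /max_dist.
exact: (@leq_bigmax_cond _ (fun ij : 'I_K * 'I_K => ij.1 != ij.2)
  (fun ij => comb_dist (C ij.1 n w) (C ij.2 n w)) (i, j)).
Qed.

(** If [i] or [j] has height at most r, every other walker has height at most 2 r. Otherwise both
    are above r, and two such walkers in different teeth are more than 2 r apart. *)
Lemma max_dist_low n w i j r : i != j -> (max_dist C n w <= r)%N ->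
  low (2 * r)%N (state C n w) || meet i j r (state C n w).
Proof.
move=> ij Dr.
have dd a b : a != b -> (comb_dist (C a n w) (C b n w) <= r)%N.
  by move=> ab; apply: leq_trans Dr; exact: comb_dist_max.
have lowif k : (absz (C k n w).2 <= r)%N -> low (2 * r)%N (state C n w).
  move=> kr; apply/forallP => l; rewrite ffunE.
  have [->|kl] := eqVneq l k; first by lia.
  have := joined_height (comb_distP (C l n w) (C k n w)); have := dd _ _ kl; lia.
have [ir|ir] := leqP (absz (C i n w).2) r; first by rewrite (lowif i).
have [jr|jr] := leqP (absz (C j n w).2) r; first by rewrite (lowif j).
rewrite /meet !ffunE (ltnW ir) (ltnW jr) !andbT orbC.
have [//|xx] := eqVneq (C i n w).1 (C j n w).1.
have := joined_teeth (comb_distP (C i n w) (C j n w)) xx; have := dd _ _ ij; lia.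
Qed.

Lemma max_dist_small n w r :
  (forall i, absz (C i n w).1 <= r)%N -> low r (state C n w) ->
  (max_dist C n w <= 4 * r)%N.
Proof.
move=> xr /forallP yr; apply/bigmax_leqP => -[i j] _ /=.
apply: leq_trans (comb_dist_le _ _) _.
have := yr i; have := yr j; rewrite !ffunE.
have := xr i; have := xr j; lia.
Qed.

End max_dist.

(** * Summability and dyadic scales *)

Section summability.
Variable R : realType.
Implicit Types u v : nat -> R.

Definition bounded_sums u : Prop := exists M, forall N, \sum_(n < N) u n <= M.

Lemma bounded_sums_le u v : (forall n, u n <= v n) -> bounded_sums v -> bounded_sums u.
Proof.
by move=> uv [M hM]; exists M => N; apply: le_trans (hM N); apply: ler_sum.
Qed.

Lemma bounded_sumsD u v : bounded_sums u -> bounded_sums v ->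
  bounded_sums (fun n => u n + v n).
Proof. by move=> [M hM] [M' hM']; exists (M + M') => N; rewrite big_split lerD. Qed.

Lemma bounded_sumsZ k u : 0 <= k -> bounded_sums u -> bounded_sums (fun n => k * u n).
Proof.
by move=> k0 [M hM]; exists (k * M) => N; rewrite -mulr_sumr ler_wpM2l.
Qed.

Lemma bounded_sums_geom (x : R) : 0 <= x < 1 -> bounded_sums (fun n => x ^+ n).
Proof.
move=> /andP[x0 x1]; exists (1 - x)^-1 => N.
rewrite -[leRHS]mulr1 ler_pdivlMl ?subr_gt0//.
have := subrX1 x N; have := exprn_ge0 N x0; set s := \sum_(_ < _) _; lra.
Qed.

Lemma nneseries_ltyP m u : (forall n, 0 <= u n) ->
  (\sum_(m <= n <oo) (u n)%:E < +oo)%E <-> bounded_sums (fun n => u (m + n)%N).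
Proof.
move=> u0; have part N : (\sum_(m <= n < m + N) (u n)%:E)%E = (\sum_(n < N) u (m + n)%N)%:E.
  rewrite sumEFin; congr _%:E; rewrite -{1}[m]add0n big_addn addKn big_mkord.
  by apply: eq_bigr => i _; rewrite addnC.
have u0' n : (0 <= (u n)%:E)%E by rewrite lee_fin.
split=> [lty|[M hM]].
  have fin : (\sum_(m <= n <oo) (u n)%:E)%E \is a fin_num.
    by rewrite ge0_fin_numE//; apply: nneseries_ge0.
  exists (fine (\sum_(m <= n <oo) (u n)%:E)%E) => N.
  by rewrite -lee_fin fineK// -part; apply: nneseries_lim_ge.
apply: (@le_lt_trans _ _ M%:E); last exact: ltry.
apply: lime_le; first by apply: is_cvg_nneseries.
apply: nearW => N; have [mN|Nm] := leqP m N.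
  by rewrite -(subnKC mN) part lee_fin.
rewrite big_geq ?(ltnW Nm)//; have := hM 0%N; rewrite big_ord0 -lee_fin; exact.
Qed.

(* 2 ^ (1/8), so that 2 ^ (n/4), 2 ^ (3n/8) and 2 ^ (n/2) are its powers. *)
Definition q8 : R := Num.sqrt (Num.sqrt (Num.sqrt 2)).

Lemma q8X8 : q8 ^+ 8 = 2.
Proof.
by rewrite -[8%N]/(2 * (2 * 2))%N !exprM !sqr_sqrtr ?sqrtr_ge0 ?ler0n.
Qed.

Lemma q8_gt1 : 1 < q8.
Proof.
rewrite ltNge; apply/negP => q1; have := q8X8.
have : q8 ^+ 8 <= 1 by rewrite exprn_ile1 ?sqrtr_ge0.
by move=> + h; rewrite h; lra.
Qed.

Lemma q8_gt0 : 0 < q8. Proof. exact: lt_trans q8_gt1. Qed.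

Lemma q8V_lt1 : 0 <= q8^-1 < 1.
Proof. by rewrite invr_ge0 (ltW q8_gt0) invf_lt1 ?q8_gt0 ?q8_gt1. Qed.

Lemma pow2_q8 n : (2 ^ n)%N%:R = q8 ^+ (4 * n) ^+ 2 :> R.
Proof. by rewrite natrX -q8X8 -!exprM; congr (_ ^+ _); lia. Qed.

Lemma sqrt_pow2 n : Num.sqrt (2 ^ n)%N%:R = q8 ^+ (4 * n) :> R.
Proof. by rewrite pow2_q8 sqrtr_sqr ger0_norm// exprn_ge0// ltW// q8_gt0. Qed.

Lemma sqrt_pow2S n : Num.sqrt (2 ^ n.+1)%N%:R <= 2 * q8 ^+ (4 * n) :> R.
Proof.
rewrite sqrt_pow2 mulnS exprD ler_wpM2r ?exprn_ge0 ?(ltW q8_gt0)//.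
rewrite -q8X8 -[8%N]/(4 + 4)%N exprD ler_peMr ?exprn_ge0 ?(ltW q8_gt0)//.
by rewrite exprn_ege1// ltW// q8_gt1.
Qed.

End summability.
Arguments q8 {R}.

Lemma trunc_log2_bounds m : (0 < m)%N ->
  (2 ^ trunc_log 2 m <= m < 2 ^ (trunc_log 2 m).+1)%N.
Proof. by move=> m0; apply: trunc_log_bounds. Qed.

Lemma trunc_log2_eq n m : (2 ^ n <= m < 2 ^ n.+1)%N -> trunc_log 2 m = n.
Proof. by move=> h; apply: trunc_log_eq. Qed.

Section borel_cantelli_real.
Context (d : measure_display) (T : measurableType d) (R : realType).
Variable P : probability T R.

Lemma ae_eventually_not (F : nat -> set T) (u : nat -> R) :
  (forall n, measurable (F n)) -> (forall n, pr P (F n) <= u n) ->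
  bounded_sums u ->
  {ae P, forall w, exists N, forall n, (N <= n)%N -> ~ F n w}.
Proof.
move=> mF Fu bu.
have b : bounded_sums (fun n => pr P (F n)) by apply: bounded_sums_le bu.
have : (\sum_(0 <= n <oo) P (F n) < +oo)%E.
  under eq_eseriesr do rewrite prE//.
  by apply/nneseries_ltyP => [n|]; [exact: pr_ge0|].
move=> /(lim_sup_set_cvg0 mF) L0.
have mL : measurable (lim_sup_set F).
  by apply: bigcapT_measurable => k; apply: bigcup_measurable.
exists (lim_sup_set F); split => // w /= nw k _; apply: contrapT => h.
apply: nw; exists k => n kn Fn; apply: h; exists n => //.
Qed.

End borel_cantelli_real.

(** * The convergent half *)

Lemma exprD_le (R : realType) (x y : R) k : 0 <= x -> 0 <= y ->
  (x + y) ^+ k <= (2 * x) ^+ k + (2 * y) ^+ k.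
Proof.
move=> x0 y0; wlog xy : x y x0 y0 / x <= y => [h|].
  by have [xy|/ltW yx] := leP x y; [|rewrite addrC [leRHS]addrC]; exact: h.
apply: (@le_trans _ _ ((2 * y) ^+ k)).
  by rewrite lerXn2r ?nnegrE ?addr_ge0 ?mulr_ge0 ?ler0n//; lra.
by rewrite lerDr exprn_ge0// mulr_ge0 ?ler0n.
Qed.

Lemma bounded_sums_shift (R : realType) (u : nat -> R) : 0 <= u 0%N ->
  bounded_sums (fun n => u n.+1) -> bounded_sums u.
Proof.
move=> u0 [M hM]; exists (u 0%N + M) => -[|N].
  by rewrite big_ord0 addr_ge0//; have := hM 0%N; rewrite big_ord0.
by rewrite big_ord_recl lerD2l; exact: hM.
Qed.

Section lower_bound.
Context (d : measure_display) (T : measurableType d) (R : realType).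
Variables (P : probability T R) (K : nat).
Hypothesis hK : (3 <= K)%N.
Variable a : nat -> R.
Hypothesis a_ge0 : forall n, 0 <= a n.
Hypothesis a_dec : nonincreasing_seq a.
Variable C : 'I_K -> nat -> T -> vertex.
Hypothesis hC : forall i, comb_random_walk P (C i).
Hypothesis hind : independent_processes P C.

(* The second summand keeps the radius far above the horizontal scale
   [2 ^ (n/4)]. *)
Let rho n : R := 2 * q8 ^+ (4 * n) * a (2 ^ n)%N + q8 ^+ (3 * n).

Let r n : nat := Num.truncn (rho n).

Let qX k : 0 < q8 ^+ k :> R. Proof. by rewrite exprn_gt0// q8_gt0. Qed.

Let q3n_ge1 n : 1 <= q8 ^+ (3 * n) :> R.
Proof. by rewrite exprn_ege1// ltW// q8_gt1. Qed.

Let rho_ge n : q8 ^+ (3 * n) <= rho n.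
Proof. by rewrite /rho lerDr !mulr_ge0 ?ler0n// ltW. Qed.

Let r_itv n : (r n)%:R <= rho n < (r n).+1%:R.
Proof. by apply: truncn_itv; apply: le_trans (rho_ge n); rewrite ltW. Qed.

Let r_gt0 n : (0 < r n)%N.
Proof. by rewrite truncn_gt0; apply: le_trans (q3n_ge1 n) (rho_ge n). Qed.

Lemma max_dist_block n m w : (2 ^ n <= m < 2 ^ n.+1)%N ->
  (max_dist C m w)%:R <= Num.sqrt m%:R * a m -> (max_dist C m w <= r n)%N.
Proof.
move=> /andP[nm mn] D; rewrite truncn_ge_nat; last first.
  by apply: le_trans (rho_ge n); rewrite ltW.
apply: le_trans D _; apply: (@le_trans _ _ (2 * q8 ^+ (4 * n) * a (2 ^ n)%N)).
  apply: ler_pM; rewrite ?sqrtr_ge0//; last exact: a_dec.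
  apply: le_trans (sqrt_pow2S R n).
  by rewrite ler_sqrt ?ler0n// ler_nat ltnW.
by rewrite /rho lerDl ltW.
Qed.

Let lowhit n : set T := [set w | exists k,
  (2 ^ n <= k <= 2 ^ n + 2 ^ n)%N /\ low (2 * r n)%N (state C k w)].

Let e : R := q8^-1.

Let q34 n : q8 ^+ (3 * n) / q8 ^+ (4 * n) = e ^+ n.
Proof.
have -> : (4 * n = 3 * n + n)%N by lia.
by rewrite exprD invfM mulrA divff ?gt_eqF// mul1r exprVn.
Qed.

Let e0 : 0 <= e < 1. Proof. exact: q8V_lt1. Qed.

Lemma pr_lowhit_le n : pr P (lowhit n) <=
  (12 ^+ K * ((4 * a 0%N + 2) ^+ 2 + 1)) *
  (8 ^+ (K - 2) * a (2 ^ n)%N ^+ (K - 2) + 4 ^+ (K - 2) * e ^+ n).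
Proof.
have /andP[e_ge0 /ltW e_le1] := e0.
apply: le_trans (pr_low_hit_le hC hind _ _ _) _; first by rewrite expn_gt0.
rewrite sumr_const !card_ord sqrt_pow2 -[X in _ * X]mulr_natr.
set L : R := q8 ^+ (4 * n); set s := (2 * r n)%N; set t := (s ^ 2).+1.
have L0 : 0 < L := qX _.
have s0 : (0 < s)%N by rewrite muln_gt0 r_gt0.
have s0' : 0 < s%:R :> R by rewrite ltr0n.
pose X : R := s%:R / L.
have X0 : 0 < X by rewrite divr_gt0.
have Y : 2 * (2 * s)%N.+1%:R / L <= 6 * X.
  rewrite /X mulrA ler_wpM2r ?invr_ge0 ?(ltW L0)//.
  by rewrite -!natrM ler_nat; lia.
have Y0 : 0 <= 2 * (2 * s)%N.+1%:R / L by rewrite divr_ge0 ?mulr_ge0 ?ler0n// ltW.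
have t0 : 0 < t%:R :> R by rewrite ltr0n.
have N : (2 ^ n + t)%N%:R / t%:R <= 1 + (X ^+ 2)^-1.
  rewrite natrD mulrDl divff ?gt_eqF// addrC lerD2l pow2_q8 -/L.
  have -> : (X ^+ 2)^-1 = L ^+ 2 / s%:R ^+ 2 by rewrite /X exprMn exprVn invf_div.
  rewrite (ler_wpM2l (sqr_ge0 L))// lef_pV2 ?posrE ?exprn_gt0//.
  by rewrite -natrX ler_nat.
have XB : X <= 4 * a (2 ^ n)%N + 2 * e ^+ n.
  have E3 : q8 ^+ (3 * n) = e ^+ n * L by rewrite -q34 divfK ?gt_eqF.
  rewrite /X ler_pdivrMr// /s natrM.
  have /andP[h _] := r_itv n; move: h; rewrite /rho -/L E3.
  by move: (r n)%:R => x; lra.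
have XB2 : X <= 4 * a 0%N + 2.
  apply: le_trans XB _; have := a_dec (leq0n (2 ^ n)).
  have : e ^+ n <= 1 by rewrite exprn_ile1.
  by move: (e ^+ n) (a _) (a _) => x y z; lra.
apply: (@le_trans _ _ (2 ^+ K * (1 + (X ^+ 2)^-1) * (6 * X) ^+ K)).
  rewrite [leLHS](_ : _ = 2 ^+ K * ((2 ^ n + t)%N%:R / t%:R) *
      (2 * (2 * s)%N.+1%:R / L) ^+ K); last by ring.
  apply: ler_pM; rewrite ?mulr_ge0 ?exprn_ge0 ?invr_ge0 ?ler0n//.
    by rewrite ler_wpM2l ?exprn_ge0 ?ler0n.
  by rewrite lerXn2r ?nnegrE ?(le_trans Y0 Y).
have -> : 2 ^+ K * (1 + (X ^+ 2)^-1) * (6 * X) ^+ K =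
    12 ^+ K * (X ^+ 2 + 1) * X ^+ (K - 2).
  rewrite mulrAC -exprMn mulrA exprMn -natrM -!mulrA; congr (_ * _).
  rewrite -[in LHS](subnK (ltnW hK)) exprD; field; rewrite gt_eqF//.
apply: ler_pM; rewrite ?mulr_ge0 ?addr_ge0 ?exprn_ge0 ?ler0n ?(ltW X0)//.
  rewrite ler_wpM2l ?exprn_ge0 ?ler0n// lerD2r lerXn2r ?nnegrE ?(ltW X0)//.
  by rewrite (le_trans (ltW X0)).
have en0 : 0 <= e ^+ n by rewrite exprn_ge0.
apply: (@le_trans _ _ ((4 * a (2 ^ n)%N + 2 * e ^+ n) ^+ (K - 2))).
  by rewrite lerXn2r ?nnegrE ?(ltW X0) ?(le_trans (ltW X0)).
apply: le_trans (exprD_le _ _ _) _; rewrite ?mulr_ge0 ?ler0n//.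
rewrite !mulrA -!natrM !exprMn lerD2l ler_wpM2l ?exprn_ge0 ?ler0n//.
by rewrite ler_iXnr ?subn_gt0// exprn_ile1.
Qed.

Let i0 : 'I_K := Ordinal (ltn_trans (isT : (0 < 2)%N) hK).
Let i1 : 'I_K := Ordinal (ltn_trans (isT : (1 < 2)%N) hK).

Let methit n : set T := [set w | exists k,
  (0 <= k <= 0 + 2 ^ n.+1)%N /\ meet i0 i1 (r n) (state C k w)].

(** Taking l = 2^(n/4) gives at most 30 l visits near the axis, while 2 r is at least 2^(3n/8). *)
Lemma pr_methit_le n : pr P (methit n) <= 60 * e ^+ n.
Proof.
have i01 : i0 != i1 by [].
apply: le_trans (pr_meet_le i01 hC hind _ (r_gt0 n) (qX (2 * n))) _.
have S := sqrt_pow2S R n; set p := q8 ^+ (2 * n) in S *.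
have p0 : 0 < p := qX _.
have S' : Num.sqrt (2 ^ n.+1)%N%:R / p <= 2 * p.
  rewrite ler_pdivrMr// -mulrA -exprD; apply: le_trans S _.
  by have -> : (4 * n = 2 * n + 2 * n)%N by lia.
have r0 : 0 < (r n)%:R :> R by rewrite ltr0n.
rewrite ler_pdivrMl//.
have /andP[_] := r_itv n; rewrite -natr1 => rr.
have r1 : 1 <= (r n)%:R :> R by rewrite ler1n.
have r3 : q8 ^+ (3 * n) <= 2 * (r n)%:R :> R.
  apply: le_trans (rho_ge n) _.
  by move: rr r1; move: (rho n) (r n)%:R => x y; lra.
have pE : q8 ^+ (3 * n) * e ^+ n = p.
  have -> : (3 * n = 2 * n + n)%N by lia.
  by rewrite exprD exprVn mulfK ?gt_eqF.
have /andP[e_ge0 _] := e0; have en0 : 0 <= e ^+ n by rewrite exprn_ge0.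
have : q8 ^+ (3 * n) * e ^+ n <= 2 * (r n)%:R * e ^+ n by rewrite ler_wpM2r.
rewrite pE; move: S' {rr r1 r3}.
move: (r n)%:R (e ^+ n) (_ / p) => x y z; lra.
Qed.

Lemma summable_LLC : bounded_sums (fun n => a (2 ^ n)%N ^+ (K - 2)) ->
  LLC P (fun n w => (max_dist C n w)%:R) (fun n => Num.sqrt n%:R * a n).
Proof.
move=> bs; have ge : bounded_sums (fun n => e ^+ n) by exact: bounded_sums_geom.
have l1 : {ae P, forall w, exists N, forall n, (N <= n)%N -> ~ lowhit n w}.
  apply: ae_eventually_not pr_lowhit_le _ => [n|]; first exact: measurable_hit.
  apply: bounded_sumsZ.
    by rewrite mulr_ge0 ?exprn_ge0 ?ler0n// addr_ge0 ?sqr_ge0.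
  by apply: bounded_sumsD; apply: bounded_sumsZ; rewrite ?exprn_ge0 ?ler0n.
have l2 : {ae P, forall w, exists N, forall n, (N <= n)%N -> ~ methit n w}.
  apply: ae_eventually_not pr_methit_le _ => [n|]; first exact: measurable_hit.
  by apply: bounded_sumsZ; rewrite ?ler0n.
apply: filterS2 l1 l2 => w [N1 h1] [N2 h2].
exists (2 ^ maxn N1 N2)%N => m Nm; rewrite ltNge; apply/negP => D.
have m0 : (0 < m)%N by apply: leq_ltn_trans Nm.
set n := trunc_log 2 m.
have nm := trunc_log2_bounds m0.
have Nn : (maxn N1 N2 <= n)%N by apply: trunc_log_max => //; exact: ltnW.
have /(max_dist_low (isT : i0 != i1))/orP[lo|me] := max_dist_block nm D.
  apply: (h1 n); first by apply: leq_trans Nn; exact: leq_maxl.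
  by exists m; split => //; move: nm; rewrite -/n expnS mul2n -addnn => /andP[-> /ltnW].
apply: (h2 n); first by apply: leq_trans Nn; exact: leq_maxr.
by exists m; split => //; move: nm => /andP[_ /ltnW].
Qed.

End lower_bound.

(** * The divergent half *)

Section second_moment.
Context (d : measure_display) (T : measurableType d) (R : realType).
Variable P : probability T R.

(* Cauchy-Schwarz for X = \sum_m w_m 1_{A_m}, in the form
   2 l X <= 1_{X > 0} + l ^ 2 X ^ 2. *)
Lemma second_moment (r : seq nat) (A : nat -> set T) (w : nat -> R)
    (H : set T) (D : R) :
  (forall m, measurable (A m)) -> measurable H -> 0 < D ->
  (forall m x, m \in r -> w m != 0 -> A m x -> H x) ->
  0 < \sum_(m <- r) w m * pr P (A m) ->
  \sum_(m <- r) \sum_(k <- r) w m * w k * pr P (A m `&` A k) <=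
    D * (\sum_(m <- r) w m * pr P (A m)) ^+ 2 ->
  D^-1 <= pr P H.
Proof.
move=> mA mH D0 hH; set S := \sum_(m <- r) w m * pr P (A m) => S0 hS.
(* This choice maximizes 2 l S - l^2 D S^2; the maximum is 1 / D. *)
pose l := (D * S)^-1.
have l0 : 0 < l by rewrite invr_gt0 mulr_gt0.
have := @pr_comb_le _ _ _ P nat (option (nat * nat)) r
  (None :: [seq Some x | x <- [seq (m, k) | m <- r, k <- r]])
  (fun m => 2 * l * w m)
  (fun x => if x is Some (m, k) then l ^+ 2 * (w m * w k) else 1)
  A (fun x => if x is Some (m, k) then A m `&` A k else H).
rewrite !big_cons !big_map !big_allpairs /= mul1r.
have -> : \sum_(m <- r) 2 * l * w m * pr P (A m) = 2 * l * S.
  by rewrite /S mulr_sumr; apply: eq_bigr => m _; rewrite mulrA.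
have -> : \sum_(m <- r) \sum_(k <- r) l ^+ 2 * (w m * w k) * pr P (A m `&` A k) =
    l ^+ 2 * \sum_(m <- r) \sum_(k <- r) w m * w k * pr P (A m `&` A k).
  rewrite mulr_sumr; apply: eq_bigr => m _; rewrite mulr_sumr.
  by apply: eq_bigr => k _; rewrite -!mulrA.
have l2 : l ^+ 2 * (D * S ^+ 2) = D^-1.
  by rewrite /l; field; rewrite !gt_eqF.
have l1 : l * S = D^-1 by rewrite /l; field; rewrite !gt_eqF.
have h2 := ler_wpM2l (sqr_ge0 l) hS.
rewrite l2 in h2.
move=> h; have {}h : 2 * l * S <= pr P H +
    l ^+ 2 * \sum_(m <- r) \sum_(k <- r) w m * w k * pr P (A m `&` A k).
  apply: h => // [[[m k]|]//|x]; first exact: measurableI.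
  rewrite big_cons big_map big_allpairs /= mul1r.
  pose X := \sum_(m <- r) w m * \1_(A m) x.
  have -> : \sum_(m <- r) 2 * l * w m * \1_(A m) x = 2 * l * X.
    by rewrite /X mulr_sumr; apply: eq_bigr => m _; rewrite mulrA.
  have -> : \sum_(m <- r) \sum_(k <- r) l ^+ 2 * (w m * w k) * \1_(A m `&` A k) x =
      l ^+ 2 * (X * X).
    rewrite big_distrlr /= mulr_sumr; apply: eq_bigr => m _.
    rewrite mulr_sumr; apply: eq_bigr => k _.
    by rewrite indicI /=; ring.
  have [Hx|nHx] := pselect (H x).
    rewrite indicE mem_set//; have := sqr_ge0 (1 - l * X); rewrite /=; nra.
  suff -> : X = 0 by rewrite !mulr0 addr0 indicE ler0n.
  rewrite /X big_seq big1// => m mr.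
  have [->|w0] := eqVneq (w m) 0; first by rewrite mul0r.
  by rewrite indicE memNset ?mulr0// => Ax; apply: nHx; exact: hH Ax.
move: h; rewrite -mulrA l1; lra.
Qed.

End second_moment.

Lemma sum_sym_le (R : realType) (r : seq nat) (x : nat -> nat -> R) :
  (forall m k, x m k = x k m) -> (forall m k, 0 <= x m k) ->
  \sum_(m <- r) \sum_(k <- r) x m k <=
  2 * \sum_(m <- r) \sum_(k <- r | (m <= k)%N) x m k.
Proof.
move=> xC x0; pose S := \sum_(m <- r) \sum_(k <- r | (m <= k)%N) x m k.
have E : S = \sum_(m <- r) \sum_(k <- r | (k <= m)%N) x m k.
  rewrite /S (eq_bigr _ (fun m _ => big_mkcond _ _)) exchange_big /=.
  apply: eq_bigr => k _; rewrite [RHS]big_mkcond /=; apply: eq_bigr => m _.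
  by rewrite xC.
rewrite mulr2n mulrDl mul1r -/S [X in _ <= X + _]E /S -big_split /=.
apply: ler_sum => m _.
rewrite [X in _ <= X + _]big_mkcond [X in _ <= _ + X]big_mkcond -big_split /=.
apply: ler_sum => k _; have := x0 m k.
by case: (leqP k m) => km; case: (leqP m k) => mk; rewrite /=; lra || lia.
Qed.

(** Spreads [f n] evenly over the 2^n times of block n, to pass from sums over blocks to sums over
    times. *)
Lemma sum_blocks (R : realType) (f : nat -> R) N :
  \sum_(1 <= m < 2 ^ N) f (trunc_log 2 m) / (2 ^ trunc_log 2 m)%N%:R =
  \sum_(n < N) f n.
Proof.
elim: N => [|N IH]; first by rewrite big_ord0 big_geq.
rewrite (@big_cat_nat _ _ _ (2 ^ N)%N) ?expn_gt0 ?leq_exp2l//= IH big_ord_recr /=.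
congr (_ + _); rewrite big_nat.
rewrite (eq_bigr (fun=> f N / (2 ^ N)%N%:R)) => [|m mN]; last first.
  by rewrite (trunc_log2_eq mN).
by rewrite -big_nat sumr_const_nat expnS mul2n -addnn addnK -[LHS]mulr_natr divfK.
Qed.

(* The potential [4 / r - 4 / sqrt j] dominates the tail of [\sum_j j ^ (-3/2)]. *)
Lemma occupation_le (R : realType) (f : nat -> R) (r : nat) (A : R) J :
  (0 < r)%N -> 0 <= A -> (forall j, f j <= 1) ->
  (forall j, (0 < j)%N -> f j <= A * (r%:R / Num.sqrt j%:R) ^+ 3) ->
  \sum_(j < J) f j <= (1 + 4 * A) * r%:R ^+ 2.
Proof.
move=> r0 A0 f1 fA; have r0' : 0 < r%:R :> R by rewrite ltr0n.
have small j : \sum_(i < j) f i <= j%:R.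
  rewrite -[leRHS](_ : \sum_(i < j) 1 = _); first by apply: ler_sum.
  by rewrite sumr_const card_ord.
(* Up to time r^2 the trivial bound [f j <= 1] is used, beyond it the decay of order 3/2. *)
have [Jr|rJ] := leqP J (r ^ 2).
  apply: le_trans (small J) _; apply: (@le_trans _ _ (r ^ 2)%N%:R).
    by rewrite ler_nat.
  by rewrite natrX ler_peMl ?sqr_ge0//; lra.
suff : \sum_(j < J) f j <= r%:R ^+ 2 + A * r%:R ^+ 3 * (4 / r%:R - 4 / Num.sqrt J%:R).
  move/le_trans; apply; rewrite [leRHS]mulrDl mul1r lerD2l.
  have -> : 4 * A * r%:R ^+ 2 = A * r%:R ^+ 3 * (4 / r%:R) by field; rewrite gt_eqF.
  rewrite ler_wpM2l ?mulr_ge0 ?exprn_ge0 ?ler0n// lerBlDr lerDl.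
  by rewrite divr_ge0 ?sqrtr_ge0 ?ler0n.
rewrite -(subnKC (ltnW rJ)); elim: (J - r ^ 2)%N => [|i IH].
  rewrite addn0 natrX sqrtr_sqr ger0_norm ?ler0n// subrr mulr0 addr0.
  by rewrite -natrX; exact: small.
rewrite addnS big_ord_recr /=; set j := (r ^ 2 + i)%N in IH *.
have j0 : (0 < j)%N by rewrite addn_gt0 expn_gt0 r0.
have := fA j j0; set s : R := Num.sqrt j%:R; set t : R := Num.sqrt j.+1%:R => fj.
have s0 : 0 < s by rewrite sqrtr_gt0 ltr0n.
have t0 : 0 < t by rewrite sqrtr_gt0 ltr0n.
have s2 : s ^+ 2 = j%:R by rewrite sqr_sqrtr ?ler0n.
have t2 : t ^+ 2 = s ^+ 2 + 1 by rewrite s2 sqr_sqrtr ?ler0n// natr1.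
have s1 : 1 <= s ^+ 2 by rewrite s2 ler1n.
have key : s^-1 ^+ 3 <= 4 / s - 4 / t.
  have -> : 4 / s - 4 / t = 4 / (s * t * (s + t)).
    have -> : 4 / s - 4 / t = 4 * (t ^+ 2 - s ^+ 2) / (s * t * (s + t)).
      by field; rewrite !gt_eqF ?addr_gt0.
    by rewrite t2; congr (_ / _); lra.
  rewrite exprVn -[leLHS]mul1r ler_pdivrMr ?exprn_gt0// mulrAC.
  rewrite ler_pdivlMr ?mulr_gt0 ?addr_gt0// mul1r.
  have st : s <= t by rewrite ler_sqrt ?ler0n// ler_nat.
  have : t ^+ 2 <= 2 * s ^+ 2 by rewrite t2; lra.
  rewrite mulrDr; have : s * t * t = s * t ^+ 2 by ring.
  have : s * t * s <= s * t ^+ 2 by rewrite expr2 mulrAC -mulrA ler_wpM2l ?(ltW s0)// ler_wpM2r// ltW.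
  have -> : s ^+ 3 = s * s ^+ 2 by ring.
  move=> h1 h2 h3; have : s * t ^+ 2 <= s * (2 * s ^+ 2) by rewrite ler_wpM2l// ltW.
  by lra.
have : A * r%:R ^+ 3 * s^-1 ^+ 3 <= A * r%:R ^+ 3 * (4 / s - 4 / t).
  by rewrite ler_wpM2l// mulr_ge0 ?exprn_ge0 ?ler0n.
move: fj IH; rewrite exprMn mulrA; set B := A * r%:R ^+ 3.
set F := \sum_(_ < _) _; lra.
Qed.

Lemma ler_exprn (R : realType) (x y : R) k : 0 <= x -> x <= y -> x ^+ k <= y ^+ k.
Proof. by move=> x0 xy; rewrite lerXn2r ?nnegrE ?(le_trans x0). Qed.

Section upper_bound.
Context (d : measure_display) (T : measurableType d) (R : realType).
Variables (P : probability T R) (K : nat).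
Hypothesis hK : (3 <= K)%N.
Variable a : nat -> R.
Hypothesis a_ge0 : forall n, 0 <= a n.
Hypothesis a_dec : nonincreasing_seq a.
Variable C : 'I_K -> nat -> T -> vertex.
Hypothesis hC : forall i, comb_random_walk P (C i).
Hypothesis hind : independent_processes P C.

Local Notation st := {ffun 'I_K -> vertex}.
Local Notation Q := (prod_chain (comb_chain R) 'I_K).

(* Normalizes [al] to be at most 1. *)
Let th : R := (1 + a 0%N)^-1.

(** The value of [a] at the right end of block n bounds it from below throughout the block. *)
Let al n : R := th * a (2 ^ n.+1)%N.

Let e : R := q8^-1.

Let L n : R := q8 ^+ (4 * n).

(* The blocks with a radius above [2 ^ (3n/8)]; the others contribute a
   convergent geometric series. *)
Let G n : bool := 8 * e ^+ n <= al n.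

(** The 4 offsets the factor 4 of [max_dist_small]. The 8 in [G] leaves room for truncation and
    keeps the radius above 2^(3n/8). *)
Let r n : nat := Num.truncn (L n * al n / 4).

Let rR n : R := (r n)%:R.

Let rR_ge0 n : 0 <= rR n. Proof. exact: ler0n. Qed.

Let e0 : 0 <= e < 1. Proof. exact: q8V_lt1. Qed.

Let L0 n : 0 < L n. Proof. by rewrite exprn_gt0// q8_gt0. Qed.

Let th0 : 0 < th.
Proof. by rewrite invr_gt0 ltr_pwDl. Qed.

Let al_ge0 n : 0 <= al n. Proof. by rewrite mulr_ge0// ltW. Qed.

Let al_le n : al n <= a (2 ^ n.+1)%N.
Proof. by rewrite ler_piMl// invf_le1 ?lerDl// ltr_pwDl. Qed.

Let al_le1 n : al n <= 1.
Proof.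
rewrite ler_pdivrMl ?ltr_pwDl// mulr1.
by apply: le_trans (a_dec (leq0n _)) _; rewrite lerDr.
Qed.

Let LE n : L n * e ^+ n = q8 ^+ (3 * n).
Proof.
rewrite /L (_ : (4 * n = 3 * n + n)%N); last by lia.
by rewrite exprD exprVn mulfK// gt_eqF// exprn_gt0// q8_gt0.
Qed.

Let G_bounds n : G n ->
  [/\ L n * al n / 8 <= rR n, rR n <= L n * al n / 4, (0 < r n)%N &
      q8 ^+ (3 * n) <= rR n].
Proof.
rewrite /G => Gn.
have q1 : 1 <= q8 ^+ (3 * n) :> R by rewrite exprn_ege1// ltW// q8_gt1.
have : L n * (8 * e ^+ n) <= L n * al n by rewrite ler_pM2l.
rewrite mulrCA LE => h.
have ge0 : 0 <= L n * al n / 4 by rewrite divr_ge0// mulr_ge0// ltW.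
have := truncn_itv ge0; rewrite -/(r n) -(@natr1 R (r n)) -/(rR n) => /andP[h1 h2].
have h3 : L n * al n / 8 <= rR n.
  by move: h h1 h2 q1; move: (rR n) (L n * al n) (@q8 R ^+ (3 * n)) => x y z; lra.
split => //; last first.
  by move: h h3; move: (rR n) (L n * al n) (@q8 R ^+ (3 * n)) => x y z; lra.
have : 0 < rR n.
  by move: h h3 q1; move: (rR n) (L n * al n) (@q8 R ^+ (3 * n)) => x y z; lra.
by rewrite ltr0n.
Qed.

Let kap n j : R := avgn Q j (fun z => (low (r n) z)%:R) (start 'I_K).

(** In each coordinate, height 0 is the most favourable start, so [kap] bounds the return
    probability from every state. *)
Let kap_sup n j z : avgn Q j (fun z => (low (r n) z)%:R) z <= kap n j.
Proof.
rewrite /kap !avgn_low; apply: ler_prod => i _.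
rewrite avgn_ge0 => [|s]; last exact: ler0n.
by apply: folded_noninc_le => [s|]; [exact: fwball_noninc|rewrite ffunE].
Qed.

Let kap_ge0 n j : 0 <= kap n j.
Proof. by apply: avgn_ge0 => z; rewrite ler0n. Qed.

Let kap_le n j : (0 < j)%N -> (0 < r n)%N -> kap n j <= (4 * rR n / Num.sqrt j%:R) ^+ K.
Proof.
move=> j0 r0; apply: le_trans (avgn_low_le_sqrt R (r n) (start 'I_K) j0) _.
rewrite card_ord lerXn2r ?nnegrE ?divr_ge0 ?mulr_ge0 ?sqrtr_ge0 ?ler0n ?rR_ge0//.
by rewrite ler_wpM2r ?invr_ge0 ?sqrtr_ge0// -!natrM ler_nat; lia.
Qed.

Let w n : R := if G n then (rR n ^+ 2)^-1 else 0.

Let v n : R := if G n then al n ^+ (K - 2) else 0.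

Let w_ge0 n : 0 <= w n.
Proof. by rewrite /w; case: ifP => // _; rewrite invr_ge0 sqr_ge0. Qed.

Let v_ge0 n : 0 <= v n.
Proof. by rewrite /v; case: ifP => // _; rewrite exprn_ge0. Qed.

Let K2 : K = (K - 2 + 2)%N. Proof. by rewrite subnK// ltnW. Qed.

(** The weight r^(-2) removes two of the K factors and leaves L^(-2) = 2^(-n), the share of one time
    in its block. *)
Let scale n (c : R) : G n ->
  w n * (c * (rR n / L n)) ^+ K = c ^+ K * ((rR n / L n) ^+ (K - 2) / (L n) ^+ 2).
Proof.
move=> Gn; have [_ _ r0 _] := G_bounds Gn.
have r0' : 0 < rR n by rewrite ltr0n.
rewrite /w Gn exprMn [(_ / _) ^+ K](_ : _ = (rR n / L n) ^+ (K - 2) * (rR n / L n) ^+ 2).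
  by rewrite [(_ / _) ^+ 2]expr_div_n; field; rewrite !gt_eqF.
by rewrite -exprD -K2.
Qed.

(** The 12 is the 6 of [avgn_low_ge] times the 2 in sqrt m <= 2 L; the 8 comes from r >= L al /
    8. *)
Let c1 : R := 12^-1 ^+ K * 8^-1 ^+ (K - 2).

Let c1_gt0 : 0 < c1.
Proof. by rewrite mulr_gt0 ?exprn_gt0 ?invr_gt0 ?ltr0n. Qed.

Let occ_lower n m : (2 ^ n <= m < 2 ^ n.+1)%N ->
  c1 * (v n / (2 ^ n)%N%:R) <= w n * kap n m.
Proof.
move=> /andP[nm mn]; rewrite /v; case: (boolP (G n)) => Gn; last first.
  by rewrite mul0r mulr0 mulr_ge0.
have [g1 g2 r0 g3] := G_bounds Gn.
have m0 : (0 < m)%N by apply: leq_trans nm; rewrite expn_gt0.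
set s : R := Num.sqrt m%:R.
have Ls : L n <= s by rewrite /L -sqrt_pow2 ler_sqrt ?ler0n ?rR_ge0// ler_nat.
have s0 : 0 < s by apply: lt_le_trans Ls.
have sL : s <= 2 * L n.
  apply: le_trans (sqrt_pow2S R n); rewrite ler_sqrt ?ler0n ?rR_ge0//.
  by rewrite ler_nat ltnW.
have rs : rR n <= 2 * s.
  apply: le_trans g2 _.
  have : L n * al n <= L n by rewrite ler_piMr// ltW.
  by move: Ls s0 {sL}; move: (L n * al n) (L n) s => x y z; lra.
have hlow := avgn_low_ge 'I_K m0 rs; rewrite card_ord in hlow.
apply: le_trans (_ : w n * (12^-1 * (rR n / L n)) ^+ K <= _).
  rewrite scale// -mulrA ler_wpM2l ?exprn_ge0 ?invr_ge0 ?ler0n ?rR_ge0//.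
  rewrite pow2_q8 -/(L n) mulrA ler_wpM2r ?invr_ge0 ?sqr_ge0//.
  rewrite -exprMn; apply: ler_exprn; first by apply: mulr_ge0; rewrite ?invr_ge0.
  rewrite ler_pdivlMr//; by move: g1; move: (rR n) (L n) (al n) => x y z; lra.
rewrite ler_wpM2l//; apply: le_trans hlow.
rewrite lerXn2r ?nnegrE ?divr_ge0 ?mulr_ge0 ?invr_ge0 ?ler0n ?rR_ge0 ?(ltW (L0 n)) ?sqrtr_ge0//.
apply: (@le_trans _ _ (rR n / (12 * L n))).
  by rewrite invfM mulrCA mulrA.
apply: ler_pM; rewrite ?ler0n ?rR_ge0 ?invr_ge0 ?mulr_ge0 ?ler0n ?rR_ge0 ?(ltW (L0 n))//.
  by rewrite ler_nat.
rewrite lef_pV2 ?posrE ?mulr_gt0//.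
by rewrite -/s; lra.
Qed.

(** At gaps of at least half a block length, the bound has the same order as the unconditional lower
    bound [occ_lower]: such pairs of times are nearly uncorrelated. *)
Let occ_far n j : (2 ^ n <= 2 * j)%N -> w n * kap n j <= 8 ^+ K * (v n / (2 ^ n)%N%:R).
Proof.
move=> nj; rewrite /v; case: (boolP (G n)) => Gn; last first.
  by rewrite /w (negbTE Gn) !mul0r mulr0.
have [g1 g2 r0 g3] := G_bounds Gn.
have j0 : (0 < j)%N.
  by move: nj; case: j => //; rewrite muln0 leqn0 expn_eq0.
apply: (@le_trans _ _ (w n * (8 * (rR n / L n)) ^+ K)).
  rewrite ler_wpM2l//; apply: le_trans (kap_le j0 r0) _.
  have s0 : 0 < Num.sqrt j%:R :> R by rewrite sqrtr_gt0 ltr0n.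
  rewrite lerXn2r ?nnegrE ?divr_ge0 ?mulr_ge0 ?invr_ge0 ?ler0n ?rR_ge0 ?(ltW (L0 n)) ?(ltW s0)//.
  have sL : L n <= 2 * Num.sqrt j%:R.
    rewrite /L -sqrt_pow2 -[X in X * _](_ : Num.sqrt (2 ^ 2)%N%:R = 2) -?sqrtrM ?ler0n ?rR_ge0//.
      by rewrite -natrM ler_sqrt ?ler0n ?rR_ge0// ler_nat; lia.
    by rewrite natrX sqrtr_sqr ger0_norm ?ler0n ?rR_ge0.
  rewrite mulrA ler_pdivrMr// mulrAC ler_pdivlMr//.
  have : rR n * L n <= rR n * (2 * Num.sqrt j%:R) by rewrite ler_wpM2l ?ler0n ?rR_ge0.
  by move: (rR n) (L n) (Num.sqrt _) => x y z; lra.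
rewrite scale// ler_wpM2l ?exprn_ge0 ?ler0n ?rR_ge0// pow2_q8 -/(L n).
rewrite ler_wpM2r ?invr_ge0 ?sqr_ge0// lerXn2r ?nnegrE ?divr_ge0 ?ler0n ?rR_ge0 ?(ltW (L0 n))//.
rewrite ler_pdivrMr//; apply: le_trans g2 _.
have : 0 <= L n * al n by rewrite mulr_ge0// ltW.
by rewrite (mulrC (al n)); move: (L n * al n) => x; lra.
Qed.

Let c2 : R := 1 + 4 * 4 ^+ K.

(** Transience in dimension K >= 3: the expected total time in a ball of radius r is of order
    r^2. *)
Let occ_total n J : \sum_(j < J) w n * kap n j <= c2.
Proof.
have c2_ge0 : 0 <= c2 by rewrite addr_ge0// mulr_ge0 ?exprn_ge0 ?ler0n ?rR_ge0.
rewrite -mulr_sumr /w; case: (boolP (G n)) => Gn; last by rewrite mul0r.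
have [g1 g2 r0 g3] := G_bounds Gn.
have r0' : 0 < rR n by rewrite ltr0n.
rewrite ler_pdivrMl ?exprn_gt0// mulrC.
have kap1 j : kap n j <= 1.
  by apply: avgn_le_cst => z; rewrite lern1 leq_b1.
apply: occupation_le => // j j0.
set x := _ / _; have x0 : 0 <= x by rewrite divr_ge0 ?sqrtr_ge0 ?ler0n ?rR_ge0.
have k4 : 1 <= 4 ^+ K :> R by rewrite exprn_ege1// ler1n.
(* For x <= 1 the power K is at most the cube that [occupation_le] sums; for x > 1 the trivial bound
   1 is enough. *)
have [x1|x1] := leP x 1; last first.
  apply: le_trans (kap1 j) _; rewrite -[leLHS]mulr1 ler_pM//.
  by rewrite exprn_ege1// ltW.
apply: le_trans (kap_le j0 r0) _; rewrite -mulrA exprMn ler_wpM2l ?exprn_ge0 ?ler0n ?rR_ge0//.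
exact: ler_wiXn2l.
Qed.

Let A m : set T := [set x | low (r (trunc_log 2 m)) (state C m x)].

Let wm m : R := w (trunc_log 2 m).

Let vm m : R := v (trunc_log 2 m) / (2 ^ trunc_log 2 m)%N%:R.

Let vm_ge0 m : 0 <= vm m.
Proof. by rewrite divr_ge0 ?ler0n ?rR_ge0. Qed.

Let mA m : measurable (A m). Proof. exact: measurable_state. Qed.

Let prA m : pr P (A m) = kap (trunc_log 2 m) m.
Proof. by rewrite /A (pr_state hC hind). Qed.

Let prAA m k : (m <= k)%N ->
  pr P (A m `&` A k) <= kap (trunc_log 2 k) (k - m) * pr P (A m).
Proof.
move=> mk; have := pr_state2_le hC hind (low (r (trunc_log 2 m))) m
  (kap_sup (trunc_log 2 k) (k - m)).
apply: le_trans; rewrite subnKC// le_eqVlt; apply/orP; left; apply/eqP.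
by congr pr; apply/seteqP; split => x /= => [[-> ->]|/andP].
Qed.

Let c3 : R := 8 ^+ K.

Let shift_sum (F : nat -> R) m N : (forall j, 0 <= F j) ->
  \sum_(m <= k < N) F (k - m)%N <= \sum_(j < N) F j.
Proof.
move=> F0; have [mN|Nm] := leqP m N; last first.
  by rewrite big_geq ?sumr_ge0// ltnW.
rewrite -{1}[m]add0n big_addn big_mkord.
rewrite (eq_bigr (fun i : 'I__ => F i)) => [|i _]; last by rewrite addnK.
by rewrite -[in leRHS](subnK mN) big_split_ord lerDl sumr_ge0.
Qed.

(** Later times in blocks n and n + 1 may be close to [m], and each of these blocks is charged a
    total occupation [c2]. For k in a later block, m is below half of its left end, so the gap is
    large enough for [occ_far]. *)
Let pair_sum M N m : (0 < M)%N -> (M <= m)%N ->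
  \sum_(M <= k < N | (m <= k)%N) wm k * kap (trunc_log 2 k) (k - m) <=
  2 * c2 + c3 * \sum_(M <= k < N) vm k.
Proof.
move=> M0 Mm; have m0 := leq_trans M0 Mm; set n := trunc_log 2 m.
have widen (F : nat -> R) :
    \sum_(m <= k < N) F k = \sum_(M <= k < N | (m <= k)%N) F k.
  by rewrite (@big_nat_widenl _ _ _ m M N xpredT).
rewrite -widen.
have vmM : \sum_(m <= k < N) vm k <= \sum_(M <= k < N) vm k.
  rewrite widen big_mkcond /=; apply: ler_sum => k _.
  by case: ifP.
apply: (@le_trans _ _ (\sum_(m <= k < N) (w n * kap n (k - m) +
    w n.+1 * kap n.+1 (k - m) + c3 * vm k))).
  rewrite big_nat [leRHS]big_nat; apply: ler_sum => k /andP[mk _].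
  have k0 := leq_trans m0 mk.
  have wk p : 0 <= w p * kap p (k - m) by rewrite mulr_ge0.
  have cv : 0 <= c3 * vm k by rewrite mulr_ge0// exprn_ge0// ler0n.
  rewrite /wm; have [->|kn] := eqVneq (trunc_log 2 k) n; first by rewrite -addrA lerDl addr_ge0.
  have [->|kn1] := eqVneq (trunc_log 2 k) n.+1.
    by rewrite [X in _ <= X + _]addrC -addrA lerDl addr_ge0.
  rewrite -[leLHS]add0r lerD ?addr_ge0//; apply: occ_far.
  have nk : (n <= trunc_log 2 k)%N by apply: leq_trunc_log.
  have nk2 : (n.+2 <= trunc_log 2 k)%N.
    by rewrite ltn_neqAle eq_sym kn1 ltn_neqAle eq_sym kn.
  have /andP[hk _] := trunc_log2_bounds k0.
  have /andP[_ hm] := trunc_log2_bounds m0; rewrite -/n in hm.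
  have : (2 ^ n.+2 <= 2 ^ trunc_log 2 k)%N by rewrite leq_exp2l.
  by rewrite expnS; move: hk hm; move: (2 ^ _)%N (2 ^ n.+1)%N => x y; lia.
rewrite !big_split /= -[X in _ + X]mulr_sumr lerD//; last first.
  by rewrite ler_wpM2l// exprn_ge0// ler0n.
have bnd p : \sum_(m <= k < N) w p * kap p (k - m) <= c2.
  apply: le_trans (occ_total p N).
  by apply: (shift_sum (F := fun j => w p * kap p j)) => j; rewrite mulr_ge0.
by have := bnd n; have := bnd n.+1; lra.
Qed.

Let hits M : set T := [set x | exists k, (M <= k)%N /\ (G (trunc_log 2 k) /\ A k x)].

Let measurable_hits M : measurable (hits M).
Proof.
rewrite (_ : hits M = \bigcup_(k in [set k | (M <= k)%N /\ G (trunc_log 2 k)]) A k).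
  by apply: bigcup_measurable => k _.
by apply/seteqP; split => x [k]; [move=> [? [? ?]]; exists k|move=> [? ?] ?; exists k].
Qed.

Let D : R := 2 * (2 * c2 + c3) / c1.

Let D_gt0 : 0 < D.
Proof.
rewrite divr_gt0// mulr_gt0// addr_gt0 ?exprn_gt0 ?ltr0n//.
by rewrite mulr_gt0// addr_gt0// mulr_gt0 ?exprn_gt0 ?ltr0n.
Qed.

(** With S the mean and V the sum of the [vm], the second moment is at most 2 S (2 c2 + c3 V), the 2
    coming from ordering the pairs. Since 1 <= V <= S / c1, this is at most D S^2. *)
Let pr_hits_ge M N : (0 < M)%N -> 1 <= \sum_(M <= k < N) vm k ->
  D^-1 <= pr P (hits M).
Proof.
move=> M0; set V := \sum_(M <= k < N) _ => V1.
have SV : c1 * V <= \sum_(M <= m < N) wm m * pr P (A m).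
  rewrite mulr_sumr big_nat [leRHS]big_nat; apply: ler_sum => m /andP[Mm _].
  rewrite prA; apply: occ_lower; apply: trunc_log2_bounds; exact: leq_trans Mm.
have S0 : 0 < \sum_(M <= m < N) wm m * pr P (A m).
  by apply: lt_le_trans SV; rewrite mulr_gt0// (lt_le_trans _ V1).
apply: (second_moment (r := index_iota M N) (A := A) (w := wm)) => //.
  move=> m x; rewrite mem_index_iota => /andP[Mm _] wm0 Ax; exists m; split => //.
  by split => //; move: wm0; rewrite /wm /w; case: ifP => //; rewrite eqxx.
apply: le_trans (sum_sym_le _ _ _) _ => [m k|m k|].
- by rewrite setIC (mulrC (wm m)).
- by rewrite !mulr_ge0 ?w_ge0 ?pr_ge0.
set S := \sum_(M <= m < N) wm m * pr P (A m) in S0 SV *.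
apply: (@le_trans _ _ (2 * (S * (2 * c2 + c3 * V)))).
  rewrite ler_wpM2l ?ler0n ?rR_ge0// mulr_suml big_nat [leRHS]big_nat.
  apply: ler_sum => m /andP[Mm _].
  apply: le_trans (_ : _ <= wm m * pr P (A m) *
    \sum_(M <= k < N | (m <= k)%N) wm k * kap (trunc_log 2 k) (k - m)) _.
    rewrite mulr_sumr; apply: ler_sum => k mk.
    rewrite -!mulrA ler_wpM2l ?w_ge0// mulrCA ler_wpM2l ?w_ge0// mulrC.
    exact: prAA.
  by rewrite ler_wpM2l ?mulr_ge0 ?w_ge0 ?pr_ge0//; exact: pair_sum.
have c20 : 0 <= c2 by rewrite addr_ge0// mulr_ge0 ?exprn_ge0 ?ler0n ?rR_ge0.
have c30 : 0 <= c3 by rewrite exprn_ge0 ?ler0n ?rR_ge0.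
have : 2 * c2 + c3 * V <= (2 * c2 + c3) * (S / c1).
  have VS : V <= S / c1 by rewrite ler_pdivlMr// mulrC.
  have := ler_wpM2l c20 (le_trans V1 VS).
  by have := ler_wpM2l c30 VS; move: (S / c1) => x; lra.
rewrite -(ler_pM2l S0) -(ler_pM2l (ltr0n R 2 : 0 < 2%:R)).
move=> h; apply: le_trans h _; rewrite /D le_eqVlt; apply/orP; left; apply/eqP.
by field; rewrite gt_eqF.
Qed.

Let widehit i n : set T := if G n then [set x | exists k,
  (0 <= k <= 0 + 2 ^ n.+1)%N /\ wide i (r n) (state C k x)] else set0.

(** [low] controls heights only. At radii above 2^(3n/8) the maximal inequality gives order 2^(n/2)
    / 2^(3n/4), so abscissas exceed the radius in finitely many blocks of [G]. *)
Let pr_widehit_le i n : pr P (widehit i n) <= 2 * e ^+ n.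
Proof.
have /andP[e_ge0 e_lt1] := e0; have en0 : 0 <= e ^+ n by rewrite exprn_ge0.
rewrite /widehit; case: (boolP (G n)) => Gn; last first.
  by rewrite /pr measure0 mulr_ge0// ler0n.
have [_ _ r0 g3] := G_bounds Gn.
apply: le_trans (pr_wide_le hC hind i _ r0) _; rewrite -/(rR n).
have r0' : 0 < rR n by rewrite ltr0n.
rewrite ler_pdivrMr ?exprn_gt0//; apply: le_trans (sqrt_pow2S R n) _.
rewrite -mulrA ler_wpM2l ?ler0n ?rR_ge0//.
apply: (@le_trans _ _ (e ^+ n * (q8 ^+ (3 * n)) ^+ 2)).
  have q1 : 1 <= q8 ^+ n :> R by rewrite exprn_ege1// ltW// q8_gt1.
  have x0 : 0 < q8 ^+ n :> R := lt_le_trans ltr01 q1.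
  rewrite /L /e exprVn !(mulnC _ n) !exprM; move: (q8 ^+ n) q1 x0 => x q1 x0.
  have -> : x^-1 * (x ^+ 3) ^+ 2 = x * x ^+ 4 by field; rewrite gt_eqF.
  by rewrite ler_peMl// exprn_ge0// ltW.
by rewrite ler_wpM2l// ler_exprn// exprn_ge0// ltW// q8_gt0.
Qed.

Lemma LLC_summable :
  LLC P (fun n w => (max_dist C n w)%:R) (fun n => Num.sqrt n%:R * a n) ->
  bounded_sums (fun n => a (2 ^ n.+1)%N ^+ (K - 2)).
Proof.
move=> llc; apply: contrapT => unb.
have ge : bounded_sums (fun n => e ^+ n) by exact: bounded_sums_geom.
have /andP[e_ge0 e_lt1] := e0.
(* Outside [G] the summand is below (8 e^n)^(K-2), so divergence must come from the blocks in
   [G]. *)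
have unbv : ~ bounded_sums v.
  move=> bv; apply: unb.
  have : bounded_sums (fun n => th^-1 ^+ (K - 2) * (v n + 8 ^+ (K - 2) * e ^+ n)).
    apply: bounded_sumsZ; first by rewrite exprn_ge0// invr_ge0 ltW.
    by apply: bounded_sumsD => //; apply: bounded_sumsZ; rewrite ?exprn_ge0 ?ler0n ?rR_ge0.
  apply: bounded_sums_le => n.
  have -> : a (2 ^ n.+1)%N = th^-1 * al n by rewrite mulKf// gt_eqF.
  have thV : 0 <= th^-1 ^+ (K - 2) by rewrite exprn_ge0// invr_ge0 ltW.
  rewrite exprMn (ler_wpM2l thV)//.
  have en0 : 0 <= e ^+ n by rewrite exprn_ge0.
  rewrite /v; case: (boolP (G n)) => Gn; first by rewrite lerDl mulr_ge0 ?exprn_ge0 ?ler0n ?rR_ge0.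
  rewrite add0r; apply: (@le_trans _ _ ((8 * e ^+ n) ^+ (K - 2))).
    by rewrite ler_exprn//; move: Gn; rewrite /G -ltNge => /ltW.
  rewrite exprMn ler_wpM2l ?exprn_ge0 ?ler0n ?rR_ge0//.
  by rewrite ler_iXnr ?subn_gt0// exprn_ile1// ltW.
(* Otherwise [pr_hits_ge] would keep every sum of [vm] from [M] on below 1, and the sums of [v]
   would be bounded. *)
have hitsD M : (0 < M)%N -> D^-1 <= pr P (hits M).
  move=> M0; apply: contrapT => nh; apply: unbv.
  exists (\sum_(1 <= m < M) vm m + 1) => N.
  rewrite -sum_blocks; have [MN|NM] := leqP M (2 ^ N).
    rewrite (big_cat_nat (n := M))//= lerD2l leNgt; apply/negP => V1.
    by apply: nh; apply: (@pr_hits_ge M (2 ^ N)) => //; exact: ltW.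
  apply: (@le_trans _ _ (\sum_(1 <= m < M) vm m)); last by rewrite lerDl.
  rewrite [leRHS](big_cat_nat (n := 2 ^ N)) ?expn_gt0 ?(ltnW NM)//= lerDl.
  exact: sumr_ge0.
have nar : {ae P, forall x, forall i, exists N, forall n, (N <= n)%N -> ~ widehit i n x}.
  apply: filter_forall => i.
  apply: ae_eventually_not (pr_widehit_le i) _ => [n|].
    by rewrite /widehit; case: ifP => // _; exact: measurable_hit.
  by apply: bounded_sumsZ; rewrite ?ler0n ?rR_ge0.
(* A late hit with all abscissas within the radius gives a distance at most 4 r <= L al <= sqrt k
   a(k), against the LLC hypothesis. *)
have fin : {ae P, forall x, exists M, (0 < M)%N /\ ~ hits M x}.
  apply: filterS2 llc nar => x [n0 hn0] /choice[N hN].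
  exists (maxn n0.+1 (2 ^ \max_i N i)); rewrite leq_max /=; split=> // -[k [Mk [Gk Ak]]].
  move: Mk; rewrite geq_max => /andP[n0k Nk].
  have k0 : (0 < k)%N by apply: leq_trans n0k.
  set n := trunc_log 2 k in Gk Ak *.
  have /andP[nk kn] := trunc_log2_bounds k0.
  have Nn : (\max_i N i <= n)%N by apply: trunc_log_max.
  have [g1 g2 r0 g3] := G_bounds Gk.
  have xs i : (absz (C i k x).1 <= r n)%N.
    rewrite leqNgt; apply/negP => wi; apply: (hN i n).
      by apply: leq_trans Nn; exact: leq_bigmax.
    rewrite /widehit Gk; exists k; split; first exact: ltnW.
    by rewrite /wide ffunE ltnW.
  have := hn0 k n0k; apply/negP; rewrite -leNgt.
  apply: (@le_trans _ _ (4 * r n)%N%:R).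
    by rewrite ler_nat; exact: max_dist_small.
  rewrite natrM; apply: (@le_trans _ _ (L n * al n)).
    by move: g2; rewrite -/(rR n); move: (rR n) (L n * al n) => y z; lra.
  apply: ler_pM; rewrite ?(ltW (L0 n))//.
    by rewrite /L -sqrt_pow2 ler_sqrt ?ler0n ?rR_ge0// ler_nat.
  by apply: le_trans (al_le n) _; apply: a_dec; exact: ltnW.
have hits_dec M M' : (M <= M')%N -> hits M' `<=` hits M.
  by move=> MM' x [k [Mk h]]; exists k; split => //; exact: leq_trans Mk.
(* Continuity from above: the limit is null by [fin], yet every term is at least 1 / D. *)
have cvg : P (hits M.+1) @[M --> \oo] --> P (\bigcap_M hits M.+1).
  apply: nonincreasing_cvg_mu => //.
  - by rewrite -ge0_fin_numE// fin_num_measure.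
  - by apply: bigcapT_measurable => M.
  - by move=> M M' MM'; apply/subsetPset; apply: hits_dec.
have hits0 : P (\bigcap_M hits M.+1) = 0%E.
  have [B [mB B0 BE]] := fin.
  apply/eqP; rewrite -measure_le0 -B0; apply: le_measure; rewrite ?inE//.
    by apply: bigcapT_measurable => M.
  move=> x hx; apply: BE => /= -[M [M0 nh]]; apply: nh.
  by have := hx M.-1 I; rewrite prednK.
rewrite hits0 in cvg.
have : (D^-1%:E <= 0)%E.
  apply: cvge_to_ge cvg _; apply: nearW => M /=.
  by rewrite prE// lee_fin; exact: hitsD.
by rewrite lee_fin leNgt invr_gt0 D_gt0.
Qed.

End upper_bound.

Theorem theorem4p4 (d : measure_display) (T : measurableType d) (R : realType)
    (P : probability T R) (K : nat) (hK : (3 <= K)%N)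
    (a : nat -> R) (a_ge0 : forall n, 0 <= a n) (a_dec : nonincreasing_seq a)
    (C : 'I_K -> nat -> T -> vertex)
    (hC : forall i, comb_random_walk P (C i))
    (hind : independent_processes P C) :
  LLC P (fun n w => (max_dist C n w)%:R) (fun n => Num.sqrt n%:R * a n) <->
  (\sum_(1 <= n <oo) ((a (2 ^ n)%N) ^+ (K - 2))%:E < +oo)%E.
Proof.
rewrite (nneseries_ltyP 1 (u := fun n => a (2 ^ n)%N ^+ (K - 2))); last first.
  by move=> n; rewrite exprn_ge0.
split => [/(LLC_summable hK a_ge0 a_dec hC hind)//|bs].
apply: (summable_LLC hK a_ge0 a_dec hC hind).
by apply: bounded_sums_shift => //; rewrite exprn_ge0.
Qed.
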